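(* Let $f:\mathbb{R}^{d_\theta}\to\mathbb{R}$ be differentiable with locally Lipschitz continuous gradient, let $\{\alpha_n\}_{n\ge0}$ be positive real numbers, and let $\{\theta_n\}_{n\ge 0}$ be $\mathbb{R}^{d_\theta}$-valued random variables on a probability space $(\Omega,\mathcal F,P)$ satisfying $$\theta_{n+1}=\theta_n-\alpha_n(\nabla f(\theta_n)+\xi_n),\qquad n\ge0,$$ where $\{\xi_n\}_{n\ge0}$ is an $\mathbb{R}^{d_\theta}$-valued stochastic process on the same space. Suppose: (1) $\lim_{n\to\infty}\alpha_n=0$ and $\sum_{n=0}^\infty\alpha_n=\infty$. (2) There is a real number $r\in(1,\infty)$ such that, w.p.1 on $\{\sup_{n\ge0}\|\theta_n\|<\infty\}$, for all $t\in(0,\infty)$, $$\limsup_{n\to\infty}\ \max_{n\le k<a(n,t)}\Big\|\sum_{i=n}^k\alpha_i\gamma_i^r\xi_i\Big\|<\infty .$$ Let $\xi$ denote this limsup for $t=1$. (3) For any compact set $Q\subset\mathbb{R}^{d_\theta}$ and any $a\in f(Q)$ there exist real numbers $\delta_{Q,a}\in(0,1]$, $\mu_{Q,a}\in(1,2]$, $M_{Q,a}\in[1,\infty)$ such that $|f(\theta)-a|\le M_{Q,a}\|\nabla f(\theta)\|^{\mu_{Q,a}}$ for all $\theta\in Q$ satisfying $|f(\theta)-a|\le\delta_{Q,a}$. Let $\hat\theta=\lim_{n\to\infty}\theta_n$, which exists w.p.1 on $\{\sup_{n\ge0}\|\theta_n\|<\infty\}$, and let $\hat\mu=\mu_{\hat\theta}$,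 $\hat p=p_{\hat\theta}$, $\hat q=q_{\hat\theta}$, $\hat r=r_{\hat\theta}$. Then there exists a random variable $\hat K$, which is a deterministic function of $\hat p$, $C_{\hat\theta}$, $M_{\hat\theta}$, such that $0<\hat K<\infty$ everywhere and $$\limsup_{n\to\infty}\gamma_n^{\hat p}\|\nabla f(\theta_n)\|^2\le\hat K(\varphi(\xi))^{\hat\mu},$$ $$\limsup_{n\to\infty}\gamma_n^{\hat p}|f(\theta_n)-f(\hat\theta)|\le\hat K(\varphi(\xi))^{\hat\mu},$$ $$\limsup_{n\to\infty}\gamma_n^{\hat q}\|\theta_n-\hat\theta\|\le\hat K\varphi(\xi)$$ w.p.1 on $\{\sup_{n\ge0}\|\theta_n\|<\infty\}$, where $$\varphi(\xi)=\begin{cases}\xi,&\text{if } r<\hat r,\\ 1+\xi,&\text{if } r=\hat r,\\ 1,&\text{if } r>\hat r.\end{cases}$$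
   Context: $\|\cdot\|$ is the Euclidean norm. $\gamma_0=0$ and $\gamma_n=\sum_{i=0}^{n-1}\alpha_i$ for $n\ge1$. For $t\in(0,\infty)$ and $n\ge0$, $a(n,t)=\max\{k\ge n:\gamma_k-\gamma_n\le t\}$. No independence or adaptedness is imposed on $\xi_n$ (it may be a random function of $\theta_0,\dots,\theta_n$). ''W.p.1 on an event $\Lambda$'' means for all $\omega\in\Lambda$ outside a set of probability zero. As a consequence of hypothesis (3), for each $\theta\in\mathbb{R}^{d_\theta}$ there exist (and are fixed once and for all) $\delta_\theta\in(0,1]$, $\mu_\theta\in(1,2]$, $M_\theta\in[1,\infty)$ such that $|f(\theta')-f(\theta)|\le M_\theta\|\nabla f(\theta')\|^{\mu_\theta}$ for all $\theta'$ with $\|\theta'-\theta\|\le\delta_\theta$. $C_\theta\in[1,\infty)$ is a number that is both an upper bound of $\|\nabla f\|$ and a Lipschitz constant of $\nabla f$ on $\{\theta':\|\theta'-\theta\|\le\delta_\theta\}$. Further, $$r_\theta=\begin{cases}1/(2-\mu_\theta),&\mu_\theta<2\\ \infty,&\mu_\theta=2\end{cases},\qquad p_\theta=\mu_\theta\min\{r,r_\theta\},\qquad q_\theta=\min\{r,r_\theta\}-1 .$$ *)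

(* Defs.v *)
From HB Require Import structures.
From mathcomp Require Import all_boot all_order all_algebra.
From mathcomp Require Import all_classical all_reals all_analysis.

Set Implicit Arguments.
Unset Strict Implicit.
Unset Printing Implicit Defensive.

Import Order.TTheory GRing.Theory Num.Theory.
Import numFieldNormedType.Exports.

Local Open Scope classical_set_scope.
Local Open Scope ring_scope.

Section Euclidean.
Context {R : realType} {d : nat}.

(* The library norm `|x| on row vectors is the sup norm; it induces the same
   topology and the same notion of differentiability, but constants such as
   Lipschitz constants depend on which norm is used. *)
Definition enorm (x : 'rV[R]_d) : R := Num.sqrt (\sum_(j < d) x ord0 j ^+ 2).

Definition grad (f : 'rV[R]_d -> R) (x : 'rV[R]_d) : 'rV[R]_d :=
  \row_(j < d) 'D_(delta_mx ord0 j) f x.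

Definition eball (x : 'rV[R]_d) (e : R) : set 'rV[R]_d :=
  [set y | enorm (y - x) <= e].

Definition elipschitz_on (L : R) (A : set 'rV[R]_d)
    (g : 'rV[R]_d -> 'rV[R]_d) : Prop :=
  forall x y, A x -> A y -> enorm (g x - g y) <= L * enorm (x - y).

Definition locally_elipschitz (g : 'rV[R]_d -> 'rV[R]_d) : Prop :=
  forall x, exists e L : R, 0 < e /\ elipschitz_on L (eball x e) g.

Definition lojasiewicz (f : 'rV[R]_d -> R) : Prop :=
  forall Q : set 'rV[R]_d, compact Q -> forall a : R, (f @` Q) a ->
  exists delta mu M : R,
    [/\ 0 < delta <= 1, 1 < mu <= 2, 1 <= M &
      forall x, Q x -> `|f x - a| <= delta ->
        `|f x - a| <= M * enorm (grad f x) `^ mu].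

Definition local_lojasiewicz (f : 'rV[R]_d -> R) (delta mu M : 'rV[R]_d -> R)
    : Prop :=
  forall x, [/\ 0 < delta x <= 1, 1 < mu x <= 2, 1 <= M x &
    forall y, eball x (delta x) y ->
      `|f y - f x| <= M x * enorm (grad f y) `^ mu x].

Definition local_grad_bound (f : 'rV[R]_d -> R) (delta C : 'rV[R]_d -> R)
    : Prop :=
  forall x, [/\ 1 <= C x,
    forall y, eball x (delta x) y -> enorm (grad f y) <= C x &
    elipschitz_on (C x) (eball x (delta x)) (grad f)].

(* Row vectors carry no sigma-algebra in the library; Borel measurability in
   R^d is measurability of all coordinates. *)
Definition random_vector disp (T : measurableType disp) (X : T -> 'rV[R]_d)
    : Prop :=
  forall j : 'I_d, measurable_fun [set: T] (fun w => X w ord0 j).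

Definition bounded_seq (x : nat -> 'rV[R]_d) : Prop :=
  (ereal_sup (range (fun n => (enorm (x n))%:E)) < +oo)%E.

End Euclidean.

Section StepSizes.
Context {R : realType}.

Definition gamma (alpha : nat -> R) (n : nat) : R :=
  \sum_(0 <= i < n) alpha i.

(* a(n,t) is the greatest element of aset alpha n t; when no greatest element
   exists (impossible if the step sizes are not summable) the value is n. *)
Definition aset (alpha : nat -> R) (n : nat) (t : R) : set nat :=
  [set k | (n <= k)%N /\ gamma alpha k - gamma alpha n <= t].

Definition awin (alpha : nat -> R) (n : nat) (t : R) : nat :=
  xget n [set k | aset alpha n t k /\
                  forall j, aset alpha n t j -> (j <= k)%N].

(* The maximum of the nonnegative quantities over an empty window is 0. *)
Definition noise_max {d : nat} (alpha : nat -> R) (r : R)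
    (xi : nat -> 'rV[R]_d) (t : R) (n : nat) : R :=
  \big[Num.max/0]_(n <= k < awin alpha n t)
    enorm (\sum_(n <= i < k.+1) (alpha i * gamma alpha i `^ r) *: xi i).

Definition noise_limsup {d : nat} (alpha : nat -> R) (r : R)
    (xi : nat -> 'rV[R]_d) (t : R) : \bar R :=
  limn_esup (fun n => (noise_max alpha r xi t n)%:E).

End StepSizes.

Section Exponents.
Context {R : realType}.

Definition r_of (mu : R) : \bar R :=
  if mu < 2 then ((2 - mu)^-1)%:E else +oo%E.

Definition min_r (r mu : R) : R := fine (Order.min r%:E (r_of mu)).

Definition p_of (r mu : R) : R := mu * min_r r mu.

Definition q_of (r mu : R) : R := min_r r mu - 1.

Definition phi (r mu : R) (xi : \bar R) : \bar R :=
  if (r%:E < r_of mu)%E then xi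
  else if r%:E == r_of mu then (1 + xi)%E else 1%E.

End Exponents.

(* Main.v *)
Require Import Defs.
From HB Require Import structures.
From mathcomp Require Import all_boot all_order all_algebra.
From mathcomp Require Import all_classical all_reals all_analysis.
From mathcomp Require Import measurable_realfun.
From mathcomp Require Import ring lra.

Set Implicit Arguments.
Unset Strict Implicit.
Unset Printing Implicit Defensive.

Import Order.TTheory GRing.Theory Num.Theory.
Import numFieldNormedType.Exports.

Local Open Scope classical_set_scope.
Local Open Scope ring_scope.

(** The statement is proved trajectory by trajectory; probability enters only
    through the almost sure event on which the averaged noise is bounded.

    Measure time by [gamma] and cut it into windows of length about
    [t = 1 / (16 C)]. Write [F] for [f (theta n)] minus its limit, [G] for the norm
    of the gradient, [rho] for the minimum of [r] and [1 / (2 - mu)], and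
    [x = B * s ^ (- rho)] for the size of the noise in a window around time [s].
    Summation by parts turns the hypothesis on the weighted noise into this bound,
    with [B] close to [xi] if [r < 1 / (2 - mu)], with [B = 1 + xi] in case of
    equality, and with [B = 1] if [r] is larger, when the noise is negligible
    against [s ^ (- rho)]. Over a short window the iteration is one long gradient
    step up to an error of the size of the noise, whence [F] changes by at most
    [- (t / 8) * G ^ 2 + 67 C x ^ 2] (window_decrease).

    With the Lojasiewicz inequality [|F| <= M G ^ mu] this reads
    [F' <= - c F ^ (2 / mu) + c' x ^ 2]. The function [K * x ^ mu], which is
    [K * B ^ mu * s ^ (- p)], is a supersolution once [K] is large: both terms
    on the right are of order [x ^ 2], and the derivative of [x ^ mu] is of the same
    or of smaller order because [rho <= 1 / (2 - mu)]. Comparison bounds [F] from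
    above (near_value_le). From below, [F] can never fall under [- K * x ^ mu], as
    it would then decrease for ever and not tend to [0] (near_value_ge). The
    decrease of [F] over one window now bounds [G ^ 2] (near_gradient_le).

    For the distance to the limit, the potential [F / x + c * s * x] decreases over
    each window by at least an eighth of the distance covered, since
    [G <= G ^ 2 / x + x], and it tends to [0] like [s * x = B * s ^ (1 - rho)]; so
    it bounds the whole remaining path (near_distance_le).

    These estimates use the Lojasiewicz inequality along the iterates only, which
    is why they also yield convergence (trajectory_cvg). On a
    ball containing the iterates the gradient is Lipschitz, the values [f (theta n)]
    decrease up to an error that tends to [0], hence converge to some [a], and the
    Lojasiewicz inequality at level [a] holds along the whole late trajectory; the
    path is therefore finite. Once the limit is known, the estimates are applied a
    second time with the constants attached to the limit (trajectory_rates). All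
    constants are explicit in [rho], [p], [C] and [M], and [1 / (rho - 1)] is
    controlled by [r] and [p]. *)

(** * Euclidean geometry of row vectors *)

Section EuclideanSpace.
Context {R : realType} {d : nat}.
Implicit Types (x y z : 'rV[R]_d) (a : R).

Definition edot x y : R := \sum_(j < d) x ord0 j * y ord0 j.

Lemma edotC x y : edot x y = edot y x.
Proof. by apply: eq_bigr => j _; rewrite mulrC. Qed.

Lemma edotDl x y z : edot (x + y) z = edot x z + edot y z.
Proof. by rewrite /edot -big_split; apply: eq_bigr => j _; rewrite mxE mulrDl. Qed.

Lemma edotZl a x y : edot (a *: x) y = a * edot x y.
Proof. by rewrite /edot mulr_sumr; apply: eq_bigr => j _; rewrite mxE mulrA. Qed.

Lemma edotDr x y z : edot x (y + z) = edot x y + edot x z.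
Proof. by rewrite edotC edotDl !(edotC x). Qed.

Lemma edotZr a x y : edot x (a *: y) = a * edot x y.
Proof. by rewrite edotC edotZl edotC. Qed.

Lemma enorm_ge0 x : 0 <= enorm x.
Proof. exact: sqrtr_ge0. Qed.

Lemma enorm_sqr x : enorm x ^+ 2 = edot x x.
Proof.
rewrite /enorm sqr_sqrtr; last by apply: sumr_ge0 => j _; exact: sqr_ge0.
by apply: eq_bigr => j _; rewrite expr2.
Qed.

Lemma enormZ a x : enorm (a *: x) = `|a| * enorm x.
Proof.
apply/eqP; rewrite -(eqrXn2 (n := 2)) ?mulr_ge0 ?enorm_ge0//.
by rewrite exprMn !enorm_sqr edotZl edotZr mulrA real_normK ?num_real// expr2.
Qed.

Lemma enormN x : enorm (- x) = enorm x.
Proof. by rewrite -scaleN1r enormZ normrN1 mul1r. Qed.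

Lemma enormBC x y : enorm (x - y) = enorm (y - x).
Proof. by rewrite -enormN opprB. Qed.

Lemma enorm0 : enorm (0 : 'rV[R]_d) = 0.
Proof. by rewrite -(scale0r 0) enormZ normr0 mul0r. Qed.

Lemma edot_eq0 x y : enorm x = 0 -> edot x y = 0.
Proof.
move=> x0; have := enorm_sqr x; rewrite x0 expr0n /= /edot => /esym/eqP.
rewrite psumr_eq0 => [/allP x_eq0|j _]; last by rewrite -expr2 sqr_ge0.
rewrite big1// => j _; have := x_eq0 j; rewrite mem_index_enum => /(_ isT).
by rewrite mulf_eq0 orbb => /eqP ->; rewrite mul0r.
Qed.

(** Cauchy-Schwarz: the square of [|y| x - |x| y] is nonnegative. *)
Lemma edot_le x y : edot x y <= enorm x * enorm y.
Proof.
have [x0|x0] := eqVneq (enorm x) 0; first by rewrite edot_eq0// x0 mul0r.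
have [y0|y0] := eqVneq (enorm y) 0; first by rewrite edotC edot_eq0// y0 mulr0.
have {x0} x0 : 0 < enorm x by rewrite lt_def x0 enorm_ge0.
have {y0} y0 : 0 < enorm y by rewrite lt_def y0 enorm_ge0.
have := sqr_ge0 (enorm (enorm y *: x - enorm x *: y)).
rewrite enorm_sqr -scaleNr !(edotDl, edotDr, edotZl, edotZr) -!enorm_sqr (edotC y x).
rewrite [X in 0 <= X](_ : _ =
  (enorm x * enorm y) * (2 * (enorm x * enorm y - edot x y))); last by ring.
by rewrite pmulr_rge0 ?mulr_gt0// pmulr_rge0// subr_ge0.
Qed.

Lemma enormD x y : enorm (x + y) <= enorm x + enorm y.
Proof.
rewrite -(ler_pXn2r (n := 2)) ?nnegrE ?addr_ge0 ?enorm_ge0//.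
rewrite enorm_sqr edotDl !edotDr -!enorm_sqr (edotC y x).
have := edot_le x y; nra.
Qed.

Lemma enorm_sum (I : Type) (s : seq I) (F : I -> 'rV[R]_d) :
  enorm (\sum_(i <- s) F i) <= \sum_(i <- s) enorm (F i).
Proof.
elim: s => [|i s IH]; first by rewrite !big_nil enorm0.
by rewrite !big_cons (le_trans (enormD _ _))// lerD2l.
Qed.

Lemma enorm_dist_triangle y x z : enorm (x - z) <= enorm (x - y) + enorm (y - z).
Proof. by rewrite (le_trans _ (enormD _ _))// addrA subrK. Qed.

Lemma normr_le_enorm x : `|x| <= enorm x.
Proof.
rewrite [leLHS]/Num.norm /= mx_normrE; apply/bigmax_leP; split; first exact: enorm_ge0.
move=> [i j] _ /=; rewrite (ord1 i) -sqrtr_sqr /enorm.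
by rewrite ler_wsqrtr// (bigD1 j)//= lerDl sumr_ge0// => k _; exact: sqr_ge0.
Qed.

Lemma enorm_le_normr x : enorm x <= d%:R * `|x|.
Proof.
have xE : x = \sum_(j < d) x ord0 j *: delta_mx ord0 j by exact: row_sum_delta.
rewrite {1}xE (le_trans (enorm_sum _ _))//.
have -> : d%:R * `|x| = \sum_(j < d) `|x|.
  by rewrite sumr_const card_ord mulr_natl.
apply: ler_sum => j _; rewrite enormZ.
have -> : enorm (delta_mx ord0 j : 'rV[R]_d) = 1.
  rewrite /enorm (bigD1 j)//= big1 => [|k kj];
    rewrite mxE ?eqxx ?(negbTE kj) ?andbF ?expr0n//=.
  by rewrite addr0 expr1n sqrtr1.
rewrite mulr1 [leRHS]/Num.norm /= mx_normrE.
exact: (le_bigmax _ (fun ij : 'I_1 * 'I_d => `|x ij.1 ij.2|) (ord0, j)).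
Qed.

Definition econvex (S : set 'rV[R]_d) :=
  forall x y a, S x -> S y -> 0 <= a <= 1 -> S (x + a *: (y - x)).

Lemma eball_convex x e : econvex (eball x e).
Proof.
move=> y z a; rewrite /eball /= => Sy Sz /andP[a0 a1].
have -> : y + a *: (z - y) - x = (1 - a) *: (y - x) + a *: (z - x).
  by apply/rowP => j; rewrite !mxE; ring.
rewrite (le_trans (enormD _ _))// !enormZ !ger0_norm ?subr_ge0//.
nra.
Qed.

Lemma diff_gradE (f : 'rV[R]_d -> R) x v : differentiable f x ->
  'd f x v = edot (grad f x) v.
Proof.
move=> df; rewrite {1}(row_sum_delta v) linear_sum /edot.
by apply: eq_bigr => j _; rewrite linearZ /= -deriveE// mxE mulrC.
Qed.

(** The mean value theorem along the segment from [x] to [y] replaces the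
    gradient at [x] by the gradient at an intermediate point; the error is
    controlled by the Lipschitz constant. *)
Lemma descent_le (f : 'rV[R]_d -> R) (S : set 'rV[R]_d) C x y :
  (forall z, differentiable f z) -> econvex S -> elipschitz_on C S (grad f) ->
  0 <= C -> S x -> S y ->
  f y - f x <= edot (grad f x) (y - x) + C * enorm (y - x) ^+ 2.
Proof.
move=> df cS lS C0 Sx Sy.
pose phi (s : R) := f (x + s *: (y - x)).
have dphi (s : R) : is_derive s 1 phi (edot (grad f (x + s *: (y - x))) (y - x)).
  have dl : is_diff s (fun s : R => x + s *: (y - x)) (fun s : R => s *: (y - x)).
    have -> : (fun s : R => s *: (y - x)) = 0 + ( *:%R^~ (y - x)).
      by apply/funext => ? /=; rewrite fctE add0r.
    exact: is_diffD.
  have dfs := differentiableP (df (x + s *: (y - x))).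
  have := is_diff_comp dl dfs => dc.
  have dd : differentiable phi s by case: dc.
  apply: DeriveDef; first exact: diff_derivable.
  rewrite deriveE//.
  have -> : 'd phi s = 'd f (x + s *: (y - x)) \o (fun s : R => s *: (y - x)) :> (_ -> _).
    exact: (diff_val (is_diff_def := dc)).
  by rewrite /= scale1r diff_gradE.
have cphi : continuous phi.
  move=> s; apply: differentiable_continuous.
  by apply/derivable1_diffP; exact: (@ex_derive _ _ _ _ _ _ _ (dphi s)).
have [s] := MVT ltr01 (fun s _ => dphi s) (continuous_subspaceT cphi).
rewrite in_itv/= => /andP[s0 s1].
rewrite /phi scale1r scale0r addr0 addrCA subrr addr0 subr0 mulr1 => ->.
set z := x + _.
have Sz : S z by apply: cS; rewrite // (ltW s0) (ltW s1).
have -> : grad f z = grad f x + (grad f z - grad f x) by rewrite addrC subrK.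
rewrite edotDl lerD2l (le_trans (edot_le _ _))//.
rewrite expr2 mulrA ler_wpM2r ?enorm_ge0// (le_trans (lS _ _ Sz Sx))//.
rewrite ler_wpM2l// /z addrAC subrr add0r enormZ gtr0_norm//.
by rewrite ler_piMl ?enorm_ge0// ltW.
Qed.

End EuclideanSpace.

(** * Step sizes, time windows and powers *)

Section RealPowers.
Context {R : realType}.
Implicit Types (p q s x y : R).

(** [x ^ (- q)] is convex, hence above its tangent at [y]; in exponential form
    this is [exp (- q * ln u) >= 1 - q * ln u] together with [ln u <= u - 1]. *)
Lemma powRN_tangent q x y : 0 <= q -> 0 < x -> 0 < y ->
  y `^ (- q) * (1 - q * ((x - y) / y)) <= x `^ (- q).
Proof.
move=> q0 x0 y0; have u0 : 0 < x / y by rewrite divr_gt0.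
have xE : x = y * (x / y) by rewrite mulrC divfK ?gt_eqF.
rewrite [X in _ <= X `^ _]xE powRM ?(ltW y0) ?(ltW u0)// ler_wpM2l ?powR_ge0//.
have -> : (x - y) / y = x / y - 1 by rewrite mulrBl divff ?gt_eqF.
rewrite /powR gt_eqF// (le_trans _ (expR_ge1Dx _))// mulNr lerD2l lerN2.
rewrite ler_wpM2l//.
have := @le_ln1Dx R (x / y - 1); rewrite addrCA subrr addr0; apply.
by lra.
Qed.

Lemma powRN_le q x y : 0 <= q -> 0 < x -> x <= y -> y `^ (- q) <= x `^ (- q).
Proof.
move=> q0 x0 xy; have y0 : 0 < y by exact: lt_le_trans xy.
rewrite !powRN lef_pV2 ?posrE ?powR_gt0//.
by apply: ge0_ler_powR => //; rewrite nnegrE ltW.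
Qed.

Lemma powRN_small q (eps : R) : 0 < q -> 0 < eps ->
  exists2 s0, 0 < s0 & forall s, s0 <= s -> s `^ (- q) <= eps.
Proof.
move=> q0 e0; exists (eps `^ (- q^-1)); first exact: powR_gt0.
move=> s hs; rewrite (le_trans (powRN_le (ltW q0) _ hs)) ?powR_gt0//.
by rewrite -powRrM mulrNN mulVf ?gt_eqF// powRr1// ltW.
Qed.

Lemma powR_sqr x : 0 <= x -> x `^ 2 = x ^+ 2.
Proof. by move=> x0; rewrite -[2]/(2%:R) powR_mulrn. Qed.

End RealPowers.

Section Windows.
Context {R : realType}.
Variables (alpha : nat -> R).
Hypothesis alpha_gt0 : forall n, 0 < alpha n.
Local Notation gam := (gamma alpha).

Lemma gammaS n : gam n.+1 = gam n + alpha n.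
Proof. by rewrite /gamma big_nat_recr. Qed.

Lemma gamma_mono n m : (n <= m)%N -> gam n <= gam m.
Proof.
elim: m => [|m IH]; first by rewrite leqn0 => /eqP ->.
rewrite leq_eqVlt => /predU1P[->//|nm]; rewrite gammaS (le_trans (IH nm))//.
by rewrite lerDl ltW.
Qed.

Lemma gamma_ge0 n : 0 <= gam n.
Proof. by rewrite (_ : 0 = gam 0) ?gamma_mono// /gamma big_geq. Qed.

Lemma gamma_le_inv n m : gam n < gam m -> (n < m)%N.
Proof. by move=> h; rewrite ltnNge; apply/negP => /gamma_mono; rewrite leNgt h. Qed.

Lemma sum_alpha n m : (n <= m)%N -> \sum_(n <= i < m) alpha i = gam m - gam n.
Proof.
move=> nm; rewrite /gamma (big_cat_nat (n := n) (m := 0) (p := m))//=.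
by rewrite addrC addrK.
Qed.

(** The discrete substitute for a time step of length [t]: at least half of the
    step is made, so that windows can be chained without losing time. *)
Definition window (t : R) (n m : nat) :=
  (n < m)%N /\ t / 2 <= gam m - gam n <= t.

Lemma exists_window_after t n :
  0 < t -> (forall A, \forall m \near \oo, A <= gam m) ->
  (forall k, (n <= k)%N -> alpha k <= t / 2) -> exists m, window t n m.
Proof.
move=> t0 gy at2.
have ex : exists m, gam n + t / 2 <= gam m.
  by have [m _ hm] := gy (gam n + t / 2); exists m; apply: hm => /=.
have [] := ex_minnP ex => -[|m] hm minm.
  by have := gamma_mono (leq0n n); lra.
have nm : (n <= m)%N.
  by rewrite -ltnS; apply: gamma_le_inv; rewrite (lt_le_trans _ hm)// ltrDl divr_gt0.
exists m.+1; split=> //; rewrite lerBrDl hm/= gammaS.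
have h : gam m < gam n + t / 2.
  by rewrite ltNge; apply/negP => /minm; rewrite ltnn.
have := at2 m nm; lra.
Qed.

(** The comparison argument goes backwards in time: it bounds a value by the value
    at the start of a window that ends there. *)
Lemma exists_window_before t N k :
  (forall n, (N <= n)%N -> alpha n <= t / 2) -> 0 < t ->
  t < gam k - gam N -> exists n, (N <= n)%N /\ window t n k.
Proof.
move=> at2 t0 tk.
have Nk : (N < k)%N by apply: gamma_le_inv; lra.
pose P n := (n < k)%N && (t / 2 <= gam k - gam n).
have ex : exists n, P n by exists N; rewrite /P Nk/=; lra.
have ub n : P n -> (n <= k)%N by case/andP => /ltnW.
have [n /andP[nk hn] maxn] := ex_maxnP ex ub.
have Nn : (N <= n)%N by apply: maxn; rewrite /P Nk/=; lra.
exists n; split=> //; split=> //; rewrite hn/=.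
have h : gam k - gam n.+1 < t / 2.
  have [nk'|] := ltnP n.+1 k.
    by rewrite ltNge; apply/negP => h; have /maxn : P n.+1; [exact/andP|rewrite ltnn].
  by move=> h; have := gamma_mono h; lra.
have := at2 n Nn; move: h; rewrite gammaS; lra.
Qed.

End Windows.

(** Used to follow a property from window to window up to arbitrarily late
    ranks, without building the sequence of windows. *)
Lemma chain_cofinal (N : nat) (P : nat -> Prop) n :
  (forall k, (N <= k)%N -> P k -> exists m, (k < m)%N /\ P m) ->
  (N <= n)%N -> P n -> forall i, exists k, [/\ (i <= k)%N, (n <= k)%N & P k].
Proof.
move=> step Nn Pn; elim=> [|i [k [ik nk Pk]]]; first by exists n.
have [m [km Pm]] := step k (leq_trans Nn nk) Pk.
by exists m; split => //; [exact: leq_ltn_trans km|exact: leq_trans (ltnW km)].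
Qed.

(** * One time window of the recursion *)

Section OneWindow.
Context {R : realType} {d : nat}.
Variables (f : 'rV[R]_d -> R) (S : set 'rV[R]_d) (C : R).
Variables (alpha : nat -> R) (theta xi : nat -> 'rV[R]_d) (N : nat).
Hypothesis f_diff : forall x, differentiable f x.
Hypothesis S_convex : econvex S.
Hypothesis C_ge1 : 1 <= C.
Hypothesis grad_lip : elipschitz_on C S (grad f).
Hypothesis alpha_gt0 : forall n, 0 < alpha n.
Hypothesis theta_rec : forall n,
  theta n.+1 = theta n - alpha n *: (grad f (theta n) + xi n).
Hypothesis theta_S : forall n, (N <= n)%N -> S (theta n).
Local Notation gam := (gamma alpha).
Local Notation G n := (enorm (grad f (theta n))).

(** The deviation from one long gradient step. *)
Lemma window_residual n j D e : (N <= n)%N -> (n <= j)%N ->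
  (forall i, (n <= i < j)%N -> enorm (theta i - theta n) <= D) ->
  enorm (\sum_(n <= i < j) alpha i *: xi i) <= e ->
  enorm (theta j - theta n + (gam j - gam n) *: grad f (theta n)) <=
  (gam j - gam n) * (C * D) + e.
Proof.
move=> Nn nj hD he.
have -> : theta j - theta n + (gam j - gam n) *: grad f (theta n) =
    - (\sum_(n <= i < j) alpha i *: (grad f (theta i) - grad f (theta n)) +
       \sum_(n <= i < j) alpha i *: xi i).
  rewrite -sum_alpha// scaler_suml -big_split/=.
  elim: j nj {hD he} => [|j IH].
    by rewrite leqn0 => /eqP ->; rewrite !big_geq// subrr addr0 oppr0.
  rewrite leq_eqVlt => /predU1P[<-|nj].
    by rewrite !big_geq// subrr addr0 oppr0.
  rewrite !big_nat_recr//= theta_rec opprD -IH//.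
  by apply/rowP => k; rewrite !mxE; ring.
rewrite enormN (le_trans (enormD _ _))// lerD// (le_trans (enorm_sum _ _))//.
rewrite -sum_alpha// mulr_suml big_nat_cond [leRHS]big_nat_cond.
apply: ler_sum => i /[!andbT] nij; rewrite enormZ gtr0_norm// ler_pM2l//.
have /andP[ni _] := nij.
rewrite (le_trans (grad_lip (theta_S (leq_trans Nn ni)) (theta_S Nn)))//.
by rewrite ler_wpM2l ?hD// (le_trans ler01).
Qed.

(** Over a window so short that [T * C <= 1 / 16], the gradient hardly varies:
    the displacement is that of one gradient step of length [T] up to the
    accumulated noise [e], and [f] decreases accordingly. *)
Lemma window_step n k e (T := gam k - gam n) : (N <= n)%N -> (n <= k)%N ->
  T * C <= 16^-1 ->
  (forall j, (n <= j <= k)%N -> enorm (\sum_(n <= i < j) alpha i *: xi i) <= e) ->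
  enorm (theta k - theta n) <= 2 * (T * G n + e) /\
  f (theta k) - f (theta n) <= - (3 / 4) * (T * G n ^+ 2) + 2 * (G n * e) + 3 * (C * e ^+ 2).
Proof.
move=> Nn nk TC he.
have C0 : 0 < C by exact: lt_le_trans C_ge1.
have e0 : 0 <= e by rewrite (le_trans (enorm_ge0 _) (he n _))// leqnn.
have T0 : 0 <= T by rewrite subr_ge0 gamma_mono.
have G0 : 0 <= G n := enorm_ge0 _.
have TG0 : 0 <= T * G n by exact: mulr_ge0.
(* [16 / 15] solves [D = T * G n + e + D / 16], the self-consistent bound on the
   displacement. *)
set D := 16 / 15 * (T * G n + e).
have D0 : 0 <= D by rewrite /D; lra.
have TCD : T * (C * D) <= 16^-1 * D by rewrite mulrA ler_wpM2r.
have dist j : (n <= j <= k)%N -> enorm (theta j - theta n) <= D.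
  elim/ltn_ind: j => j IH /andP[nj jk].
  have Tj : 0 <= gam j - gam n <= T.
    by rewrite subr_ge0 gamma_mono//= lerD2r gamma_mono.
  have h : forall i, (n <= i < j)%N -> enorm (theta i - theta n) <= D.
    by move=> i /andP[ni ij]; apply: IH => //; rewrite ni (leq_trans (ltnW ij)).
  have := window_residual Nn nj h (he j _); rewrite nj jk => /(_ isT) res.
  have -> : theta j - theta n =
      (theta j - theta n + (gam j - gam n) *: grad f (theta n)) +
      (- (gam j - gam n)) *: grad f (theta n) by rewrite scaleNr addrK.
  rewrite (le_trans (enormD _ _))// enormZ normrN.
  rewrite (ger0_norm (proj1 (andP Tj))).
  have CD0 : 0 <= C * D by rewrite mulr_ge0// ltW.
  have h1 : (gam j - gam n) * (C * D) <= T * (C * D) by rewrite ler_wpM2r; case/andP: Tj.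
  have h2 : (gam j - gam n) * G n <= T * G n by rewrite ler_wpM2r; case/andP: Tj.
  have DE : D = 16 / 15 * (T * G n + e) by [].
  lra.
have nkk : (n <= k <= k)%N by rewrite nk leqnn.
split; first by rewrite (le_trans (dist _ nkk))// /D; lra.
have h : forall i, (n <= i < k)%N -> enorm (theta i - theta n) <= D.
  by move=> i /andP[ni ik]; apply: dist; rewrite ni ltnW.
have res := window_residual Nn nk h (he k nkk).
have := descent_le f_diff S_convex grad_lip (ltW C0) (theta_S Nn) (theta_S (leq_trans Nn nk)).
have -> : theta k - theta n =
    (theta k - theta n + T *: grad f (theta n)) + (- T) *: grad f (theta n).
  by rewrite scaleNr addrK.
rewrite {1}edotDr edotZr -enorm_sqr scaleNr addrK => desc.
have inner : edot (grad f (theta n)) (theta k - theta n + T *: grad f (theta n)) <=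
    G n * (T * (C * D) + e).
  by rewrite (le_trans (edot_le _ _))// ler_wpM2l.
have GD : G n * (T * (C * D) + e) <= G n * (16^-1 * D + e) by rewrite ler_wpM2l// lerD2r.
have Dk := dist k nkk.
have CD : C * enorm (theta k - theta n) ^+ 2 <= C * D ^+ 2.
  by rewrite ler_pM2l// ler_pXn2r ?nnegrE ?enorm_ge0.
have CD2 : C * D ^+ 2 <= 256 / 225 * (2 * (16^-1 * (T * G n ^+ 2)) + 2 * (C * e ^+ 2)).
  have -> : C * D ^+ 2 = 256 / 225 * (C * (T * G n + e) ^+ 2) by rewrite /D; field.
  apply: ler_wpM2l; first by rewrite divr_ge0.
  have h1 : C * (T * G n + e) ^+ 2 <= 2 * (C * (T * G n) ^+ 2) + 2 * (C * e ^+ 2).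
    have : 0 <= C * (T * G n - e) ^+ 2 by rewrite mulr_ge0 ?sqr_ge0 ?ltW.
    move: (T * G n) => u; lra.
  have h2 : C * (T * G n) ^+ 2 <= 16^-1 * (T * G n ^+ 2).
    have -> : C * (T * G n) ^+ 2 = (T * C) * (T * G n ^+ 2) by ring.
    by rewrite ler_wpM2r// mulr_ge0// sqr_ge0.
  lra.
have E : G n * (16^-1 * D + e) = 15^-1 * (T * G n ^+ 2) + 16 / 15 * (G n * e).
  by rewrite /D; field.
have Ge : 0 <= G n * e by exact: mulr_ge0.
have Ce : 0 <= C * e ^+ 2 by rewrite mulr_ge0 ?sqr_ge0 ?ltW.
have TG2 : 0 <= T * G n ^+ 2 by rewrite mulr_ge0 ?sqr_ge0.
lra.
Qed.

(** Over a full window the term linear in the noise is absorbed by part of the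
    decrease. *)
Lemma window_decrease n k e : (N <= n)%N ->
  window alpha (16 * C)^-1 n k ->
  (forall j, (n <= j <= k)%N -> enorm (\sum_(n <= i < j) alpha i *: xi i) <= e) ->
  f (theta k) <= f (theta n) - (8 * (16 * C))^-1 * G n ^+ 2 + 67 * (C * e ^+ 2).
Proof.
move=> Nn [nk /andP[T1 T2]] he.
have C0 : 0 < C by exact: lt_le_trans C_ge1.
have e0 : 0 <= e by rewrite (le_trans (enorm_ge0 _) (he n _))// leqnn ltnW.
have TC : (gam k - gam n) * C <= 16^-1.
  by rewrite -ler_pdivlMr// -invfM.
have [_] := window_step Nn (ltnW nk) TC he.
set T := gam k - gam n in T1 T2 *; set g := G n; set F := f (theta k).
have g0 : 0 <= g := enorm_ge0 _.
have T1' : (32 * C)^-1 <= T by apply: le_trans T1; rewrite -invfM mulrAC -natrM.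
(* Completing the square; [(32 * C)^-1] is the least length of a window. *)
have ge2 : 2 * (g * e) <= 2^-1 * ((32 * C)^-1 * g ^+ 2) + 64 * (C * e ^+ 2).
  have h := sqr_ge0 (g / (8 * C) - 8 * e).
  have : 0 <= C * (g / (8 * C) - 8 * e) ^+ 2 by rewrite mulr_ge0// ltW.
  have -> : C * (g / (8 * C) - 8 * e) ^+ 2 =
    (64 * C)^-1 * g ^+ 2 + 64 * (C * e ^+ 2) - 2 * (g * e).
    by field; rewrite gt_eqF.
  have -> : (32 * C)^-1 = 2 * (64 * C)^-1 by field; rewrite gt_eqF.
  lra.
have hT : (32 * C)^-1 * g ^+ 2 <= T * g ^+ 2 by rewrite ler_wpM2r// sqr_ge0.
have -> : (8 * (16 * C))^-1 = 4^-1 * (32 * C)^-1 by field; rewrite gt_eqF.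
lra.
Qed.

End OneWindow.

(** * The noise scale *)

Section NoiseScale.
Context {R : realType}.
Implicit Types (B rho mu s u c : R).

(** The size of the noise accumulated over a unit of time around time [s]. *)
Definition noise_scale B rho s : R := B * s `^ (- rho).

Lemma noise_scale_gt0 B rho s : 0 < B -> 0 < s -> 0 < noise_scale B rho s.
Proof. by move=> B0 s0; rewrite mulr_gt0// powR_gt0. Qed.

Lemma noise_scale_le B rho s u : 0 < B -> 0 <= rho -> 0 < s -> s <= u ->
  noise_scale B rho u <= noise_scale B rho s.
Proof. by move=> B0 r0 s0 su; rewrite ler_pM2l// powRN_le. Qed.

Lemma noise_scale_tangent B rho s u : 0 < B -> 0 <= rho -> 0 < s -> 0 < u ->
  noise_scale B rho s * (1 - rho * ((u - s) / s)) <= noise_scale B rho u.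
Proof. by move=> B0 r0 s0 u0; rewrite -mulrA ler_pM2l// powRN_tangent. Qed.

Lemma powR_noise_scale B rho mu s : 0 <= B ->
  noise_scale B rho s `^ mu = B `^ mu * s `^ (- (mu * rho)).
Proof.
by move=> B0; rewrite /noise_scale powRM ?powR_ge0// -powRrM mulNr (mulrC rho).
Qed.

Lemma noise_scale_time B rho s : 0 < s ->
  s * noise_scale B rho s = B * s `^ (- (rho - 1)).
Proof.
move=> s0; rewrite /noise_scale mulrCA opprB addrC powRD; last first.
  by rewrite (gt_eqF s0) implybT.
by rewrite powRr1 ?ltW// (mulrC s).
Qed.

Lemma noise_scale_small B rho (eps : R) : 0 < B -> 0 < rho -> 0 < eps ->
  exists2 s0, 0 < s0 & forall s, s0 <= s -> noise_scale B rho s <= eps.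
Proof.
move=> B0 r0 e0.
have [s0 s00 hs] := powRN_small r0 (divr_gt0 e0 B0).
by exists s0 => // s /hs; rewrite /noise_scale ler_pdivlMr// mulrC.
Qed.

(** The relation [rho <= 1 / (2 - mu)] between the two exponents says that
    [x ^ mu / s], the speed at which [x ^ mu] decays, is at most of the order of
    [x ^ 2] for [x = noise_scale B rho s]; in the critical case they are of the
    same order. *)
Lemma noise_scale_drift B rho mu c1 c2 : 0 < B -> 0 < c1 -> 0 < c2 -> mu <= 2 ->
  rho * (2 - mu) < 1 \/ [/\ rho * (2 - mu) = 1, 1 <= B & c1 <= c2] ->
  exists2 s0, 0 < s0 & forall s, s0 <= s ->
    c1 * (noise_scale B rho s `^ mu / s) <= c2 * noise_scale B rho s ^+ 2.
Proof.
move=> B0 c10 c20 mu2 H.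
pose k := 1 - rho * (2 - mu).
suff [s0 s00 hs] : exists2 s0, 0 < s0 & forall s, s0 <= s ->
    c1 * B `^ mu * s `^ (- k) <= c2 * B ^+ 2.
  exists s0 => // s ss; have s_gt0 : 0 < s by exact: lt_le_trans ss.
  rewrite powR_noise_scale ?(ltW B0)// /noise_scale exprMn.
  have -> : B `^ mu * s `^ (- (mu * rho)) / s =
      B `^ mu * s `^ (- k) * (s `^ (- rho)) ^+ 2.
    rewrite -powR_inv1 ?(ltW s_gt0)// -powR_mulrn ?powR_ge0// -powRrM -!mulrA.
    rewrite -!powRD ?(gt_eqF s_gt0) ?implybT//.
    by congr (_ * (_ `^ _)); rewrite /k; ring.
  rewrite [leLHS]mulrA [leRHS]mulrA ler_wpM2r ?sqr_ge0// mulrA; exact: hs.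
case: H => [H|[H B1 c12]].
  have k0 : 0 < k by rewrite subr_gt0.
  have e0 : 0 < c2 * B ^+ 2 / (c1 * B `^ mu).
    by rewrite divr_gt0 ?mulr_gt0 ?powR_gt0 ?exprn_gt0.
  have [s0 s00 hs] := powRN_small k0 e0.
  exists s0 => // s /hs.
  by rewrite ler_pdivlMr ?mulr_gt0 ?powR_gt0// mulrC.
exists 1 => // s _; rewrite /k H subrr oppr0 powRr0 mulr1.
rewrite ler_pM ?powR_ge0 ?(ltW c10)// -powR_sqr ?(ltW B0)//.
exact: ler_powR.
Qed.

End NoiseScale.

Section LowerGradient.
Context {R : realType}.

(** Raising both sides to the power [2 / mu] isolates [G ^ 2], the quantity that
    governs the decrease of the objective. *)
Lemma lojasiewicz_inv (mu M c x G : R) : 1 < mu <= 2 -> 0 < M -> 0 <= x -> 0 <= G ->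
  0 <= c -> c * x `^ mu <= M * G `^ mu -> (c / M) `^ (2 / mu) * x ^+ 2 <= G ^+ 2.
Proof.
move=> /andP[mu1 mu2] M0 x0 G0 c0 h.
have mu0 : 0 < mu by lra.
have muK y : 0 <= y -> (y `^ mu) `^ (2 / mu) = y ^+ 2.
  by move=> y0; rewrite -powRrM mulrCA divff ?gt_eqF// mulr1 powR_sqr.
rewrite -(muK x)// -(muK G)// -powRM ?powR_ge0 ?divr_ge0 ?(ltW M0)//.
apply: ge0_ler_powR; rewrite ?nnegrE ?powR_ge0 ?divr_ge0 ?mulr_ge0 ?invr_ge0
  ?powR_ge0 ?(ltW M0) ?(ltW mu0)//.
by rewrite mulrAC ler_pdivrMr// [leRHS]mulrC.
Qed.

Lemma powR_two_div_ge (mu u : R) : 1 < mu <= 2 -> 1 <= u -> u <= u `^ (2 / mu).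
Proof.
move=> /andP[mu1 mu2] u1; apply: le1r_powR => //.
by rewrite ler_pdivlMr ?mul1r//; lra.
Qed.

End LowerGradient.

(** * Inequalities over one window, and constants *)

(** The real inequalities behind the steps over one window, with letters for the
    values at its two ends ([0] and [1]). *)
Section ScalarSteps.
Context {R : realType}.
Implicit Types F h q : R.

Lemma noise_quarter (w C K y z : R) : 4 * (w * C) <= K -> C * y <= C * z ->
  0 <= w -> 0 <= z -> w * (C * y) <= 4^-1 * (K * z).
Proof.
move=> hK yz w0 z0; have := ler_wpM2r z0 hK; have := ler_wpM2l w0 yz.
lra.
Qed.

Lemma mul_half_le F K y : K * y / 2 < F -> K / 2 * y <= F.
Proof. by lra. Qed.

(** A bound [h] that loses at most a quarter of its value leaves room for a
    noise of [h / 4] when [F0] starts from [h / 2]. *)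
Lemma supersolution_half F0 F1 h h1 q dec noise : F1 <= F0 - dec + noise ->
  0 <= dec -> noise <= 4^-1 * h -> F0 <= h / 2 -> q <= 4^-1 -> 0 <= h ->
  h * (1 - q) <= h1 -> F1 <= h1.
Proof. by move=> *; nra. Qed.

(** One half of the decrease pays for the noise, the other half for the decay of
    the bound. *)
Lemma supersolution_drop F0 F1 h h1 q dec noise e : F1 <= F0 - dec + noise ->
  2 * e <= dec -> noise <= e -> F0 <= h ->
  h * (1 - q) <= h1 -> h * q <= e -> F1 <= h1.
Proof. by move=> *; lra. Qed.

Lemma gradient_step F0 F1 (dec K2 C y z : R) : F1 <= F0 - dec + 67 * (C * y) ->
  `|F0| <= K2 * z -> `|F1| <= K2 * z -> C * y <= C * z ->
  dec <= (2 * K2 + 67 * C) * z.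
Proof. by rewrite !ler_norml => h /andP[_ h0] /andP[h1 _] yz; lra. Qed.

(** The variation of [F / x] splits into that of [F] and that of [1 / x]; the
    latter is paid for by the decay rate of [x] and by the smallness of [F1]. *)
Lemma quotient_step F0 F1 (x0 x1 y1 g0 g1 T D C K2 rho : R) :
  0 < x0 -> 0 < x1 -> x1 <= x0 -> 0 < g0 -> g1 = g0 + T -> T <= g0 ->
  0 <= T -> T <= 2^-1 -> 0 <= rho -> 0 <= K2 ->
  F1 <= F0 - D + 67 * (C * x0 ^+ 2) -> `|F1| <= K2 * y1 -> y1 / g1 <= x1 ^+ 2 ->
  x0 * (1 - rho * (T / g0)) <= x1 ->
  F1 / x1 - F0 / x0 <= - (D / x0) + (67 * C + rho * K2) * x0.
Proof.
move=> x00 x10 x10le g00 g1E Tg T0 T2 rho0 K20 hF hF1 hy hx.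
have -> : F1 / x1 - F0 / x0 = (F1 - F0) / x0 + F1 / x1 * (1 - x1 / x0).
  by field; rewrite !gt_eqF.
have h1 : (F1 - F0) / x0 <= - (D / x0) + 67 * C * x0.
  rewrite ler_pdivrMr//.
  have -> : (- (D / x0) + 67 * C * x0) * x0 = - D + 67 * (C * x0 ^+ 2).
    by field; rewrite gt_eqF.
  lra.
have q0 : 0 <= 1 - x1 / x0 by rewrite subr_ge0 ler_pdivrMr// mul1r.
have q1 : 1 - x1 / x0 <= rho * (T / g0).
  have : 1 - rho * (T / g0) <= x1 / x0 by rewrite ler_pdivlMr// mulrC.
  lra.
have g10 : 0 < g1 by rewrite g1E ltr_pwDl.
have h2 : F1 / x1 <= K2 * (x1 * g1).
  rewrite ler_pdivrMr// (le_trans (ler_norm _))// (le_trans hF1)//.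
  rewrite -mulrA ler_wpM2l//.
  by rewrite mulrAC -expr2 -ler_pdivrMr.
have h3 : F1 / x1 * (1 - x1 / x0) <= K2 * (x1 * g1) * (rho * (T / g0)).
  rewrite (le_trans (ler_wpM2r q0 h2))// ler_wpM2l//.
  by rewrite mulr_ge0// mulr_ge0// ltW.
have h4 : K2 * (x1 * g1) * (rho * (T / g0)) <= rho * K2 * x0.
  have -> : K2 * (x1 * g1) * (rho * (T / g0)) = rho * K2 * (x1 * (T * (g1 / g0))) by ring.
  rewrite ler_wpM2l ?mulr_ge0// (le_trans _ x10le)// ler_piMr ?(ltW x10)//.
  have gg : g1 / g0 <= 2 by rewrite ler_pdivrMr// g1E; lra.
  have gg0 : 0 <= g1 / g0 by rewrite divr_ge0 ?ltW.
  nra.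
lra.
Qed.

(** [2 * G <= G ^ 2 / x + x]: the length of a step is bounded by the decrease it
    causes and the noise. *)
Lemma move_step (t G x D : R) : 0 < x -> 0 <= t -> t <= 1 -> D = t / 8 * G ^+ 2 ->
  2 * (t * G + x) <= 8 * (D / x + x).
Proof.
move=> x0 t0 t1 ->; have := sqr_ge0 (G / x - 1).
have -> : t / 8 * G ^+ 2 / x = t / 8 * (G / x) ^+ 2 * x by field; rewrite gt_eqF.
have -> : t * G = t * (G / x) * x by field; rewrite gt_eqF.
move: (G / x) => u hu.
have h : t * (2 * u) <= t * (u ^+ 2 + 1) by rewrite ler_wpM2l//; lra.
have := ler_wpM2r (ltW x0) h; nra.
Qed.

Lemma half_neg_absurd (w : R) : w < 0 -> - w <= - w / 2 -> False.
Proof. by lra. Qed.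

Lemma potential_drop (F0 F1 x0 D c y0 y1 k : R) :
  F1 - F0 <= - D + k * x0 -> (k + 1) * x0 <= c * (y0 - y1) ->
  D + x0 <= F0 + c * y0 - (F1 + c * y1).
Proof. by lra. Qed.

Lemma negative_potential (w v K2 y : R) : 0 < K2 -> w < 0 -> v <= w ->
  y * (2 * K2) <= - w -> - (K2 * y) <= v -> False.
Proof. by lra. Qed.

End ScalarSteps.

Section RateConstants.
Context {R : realType}.
Implicit Types p C M mu rho : R.

(** With [u = value_const / (2 M)], the summand [(131 C) ^ 2] makes
    [u / (256 C)] at least [67 C], as [131 ^ 2 > 256 * 67], so that the decrease
    dominates the noise; the exponential makes [u ^ (1 / p)] at least [32 p M],
    which is what the decay of [s ^ (- p)] costs when [rho = 1 / (2 - mu)]. *)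
Definition value_const p C M : R :=
  2 * M * ((131 * C) ^+ 2 + expR (32 * p ^+ 2 * M)).

Definition abs_const p C M : R := 2 `^ p * value_const p C M.

Definition grad_const p C M : R :=
  8 * (16 * C) * (2 * abs_const p C M + 67 * C).

Definition dist_const rho p C M : R :=
  4 * (16 * C) / (rho - 1) * (67 * C + rho * abs_const p C M + 1).

Lemma value_const_gt0 p C M : 0 < M -> 0 < value_const p C M.
Proof.
move=> M0; rewrite mulr_gt0 ?mulr_gt0//; apply: ltr_wpDl; [exact: sqr_ge0|exact: expR_gt0].
Qed.

Lemma value_const_le_abs p C M : 0 < M -> 0 <= p -> value_const p C M <= abs_const p C M.
Proof.
move=> M0 p0; rewrite /abs_const ler_peMl//; first exact/ltW/value_const_gt0.
by rewrite -[leLHS](powRr0 2); apply: ler_powR; rewrite ?ler1n.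
Qed.

Lemma abs_const_gt0 p C M : 0 < M -> 0 < abs_const p C M.
Proof. by move=> M0; rewrite mulr_gt0 ?powR_gt0 ?value_const_gt0. Qed.

Lemma value_const_ratio p C M : 0 < M ->
  value_const p C M / 2 / M = (131 * C) ^+ 2 + expR (32 * p ^+ 2 * M).
Proof.
move=> M0; rewrite /value_const; set v := _ + expR _.
by field; rewrite gt_eqF.
Qed.

Lemma value_const_ratio_ge p C M : 0 < M ->
  (131 * C) ^+ 2 <= value_const p C M / 2 / M.
Proof. by move=> M0; rewrite value_const_ratio// lerDl expR_ge0. Qed.

Lemma value_const_ratio_powR_ge p C M mu : 0 < M -> 1 <= C -> 1 < mu <= 2 ->
  (131 * C) ^+ 2 <= (value_const p C M / 2 / M) `^ (2 / mu).
Proof.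
move=> M0 C1 mu12; rewrite (le_trans (value_const_ratio_ge p C M0))//.
apply: powR_two_div_ge => //; rewrite (le_trans _ (value_const_ratio_ge p C M0))//.
by rewrite exprn_ege1//; lra.
Qed.

(** When [rho = 1 / (2 - mu)] one has [2 / mu = 1 + 1 / p], so the claim becomes
    [32 * p * M <= u ^ (1 / p)] for the ratio [u] of the previous lemmas. *)
Lemma value_const_critical rho mu C M (p := mu * rho) : 0 < M -> 1 < mu ->
  0 < rho -> rho * (2 - mu) = 1 ->
  16 * p * value_const p C M <= (value_const p C M / 2 / M) `^ (2 / mu).
Proof.
move=> M0 mu1 rho0 crit; have mu0 : 0 < mu by lra.
have p0 : 0 < p by exact: mulr_gt0.
have pE : 2 / mu = 1 + p^-1.
  have -> : p^-1 = (rho * (2 - mu)) * (mu * rho)^-1 by rewrite crit mul1r.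
  by field; rewrite !gt_eqF.
set K := value_const p C M; set u := K / 2 / M.
have u0 : 0 < u by rewrite !divr_gt0// value_const_gt0.
rewrite pE powRD; last by rewrite (gt_eqF u0) implybT.
rewrite powRr1 ?(ltW u0)//.
have KE : K = 2 * M * u by rewrite /u; field; rewrite gt_eqF.
have -> : 16 * p * K = u * (32 * p * M) by rewrite KE; ring.
rewrite ler_pM2l//.
have e_le_u : expR (32 * p ^+ 2 * M) <= u.
  by rewrite /u value_const_ratio// lerDr sqr_ge0.
have : expR (32 * p ^+ 2 * M) `^ p^-1 <= u `^ p^-1.
  by apply: ge0_ler_powR e_le_u; rewrite ?nnegrE ?expR_ge0 ?invr_ge0 ?ltW.
apply: le_trans; rewrite -expRM.
have -> : 32 * p ^+ 2 * M * p^-1 = 32 * p * M by field; rewrite gt_eqF.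
by rewrite (le_trans _ (expR_ge1Dx _))// lerDr.
Qed.

End RateConstants.

(** * Rates under a Lojasiewicz inequality *)

Section Rate.
Context {R : realType} {d : nat}.
Variables (f : 'rV[R]_d -> R) (S : set 'rV[R]_d) (C : R).
Variables (alpha : nat -> R) (theta xi : nat -> 'rV[R]_d) (N : nat).
Hypothesis f_diff : forall x, differentiable f x.
Hypothesis S_convex : econvex S.
Hypothesis C_ge1 : 1 <= C.
Hypothesis grad_lip : elipschitz_on C S (grad f).
Hypothesis alpha_gt0 : forall n, 0 < alpha n.
Hypothesis theta_rec : forall n,
  theta n.+1 = theta n - alpha n *: (grad f (theta n) + xi n).
Hypothesis theta_S : forall n, (N <= n)%N -> S (theta n).
Local Notation gam := (gamma alpha).
Local Notation G n := (enorm (grad f (theta n))).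
Local Notation t := (16 * C)^-1.

Hypothesis gamma_y : forall A, \forall n \near \oo, A <= gam n.
Hypothesis alpha_0 : forall eps, 0 < eps -> \forall n \near \oo, alpha n <= eps.

Variables (B rho : R).
Hypothesis B_gt0 : 0 < B.
Hypothesis rho_gt1 : 1 < rho.
Local Notation x n := (noise_scale B rho (gam n)).
Hypothesis noise : forall n j, (N <= n)%N -> (n <= j)%N -> gam j - gam n <= 1 ->
  enorm (\sum_(n <= i < j) alpha i *: xi i) <= x n.

Let C_gt0 : 0 < C. Proof. exact: lt_le_trans C_ge1. Qed.
Let rho_ge0 : 0 <= rho. Proof. by rewrite ltW// (lt_trans ltr01). Qed.
Let t_gt0 : 0 < t. Proof. by rewrite invr_gt0 mulr_gt0. Qed.
Let t_le1 : t <= 1.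
Proof. by rewrite invf_le1 ?mulr_gt0//; move: C_ge1; lra. Qed.
Let b_gt0 : 0 < (8 * (16 * C))^-1. Proof. by rewrite invr_gt0 !mulr_gt0. Qed.

(** Windows are shorter than the unit of time over which the noise is controlled. *)
Lemma window_noise n m j : (N <= n)%N -> window alpha t n m -> (n <= j <= m)%N ->
  enorm (\sum_(n <= i < j) alpha i *: xi i) <= x n.
Proof.
move=> Nn [nm /andP[_ tm]] /andP[nj jm]; apply: noise => //.
rewrite (le_trans _ t_le1)// (le_trans _ tm)// lerD2r; exact: gamma_mono.
Qed.

Lemma window_value n m : (N <= n)%N -> window alpha t n m ->
  f (theta m) <= f (theta n) - (8 * (16 * C))^-1 * G n ^+ 2 + 67 * (C * x n ^+ 2).
Proof.
move=> Nn w; have wn j := @window_noise n m j Nn w.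
exact: (window_decrease f_diff S_convex C_ge1 grad_lip alpha_gt0 theta_rec theta_S Nn w wn).
Qed.

Lemma window_move n m k : (N <= n)%N -> window alpha t n m -> (n <= k <= m)%N ->
  enorm (theta k - theta n) <= 2 * (t * G n + x n) /\
  f (theta k) <= f (theta n) + 2 * (G n * x n) + 3 * (C * x n ^+ 2).
Proof.
move=> Nn w /andP[nk km]; have [nm /andP[_ tm]] := w.
have Tt : gam k - gam n <= t by rewrite (le_trans _ tm)// lerD2r gamma_mono.
have T0 : 0 <= gam k - gam n by rewrite subr_ge0 gamma_mono.
have TC : (gam k - gam n) * C <= 16^-1.
  by rewrite -ler_pdivlMr// -invfM.
have nois j : (n <= j <= k)%N -> enorm (\sum_(n <= i < j) alpha i *: xi i) <= x n.
  by move=> /andP[nj jk]; apply: (window_noise Nn w); rewrite nj (leq_trans jk).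
have [h1 h2] := window_step f_diff S_convex C_ge1 grad_lip alpha_gt0 theta_rec theta_S
  Nn nk TC nois.
have G0 := enorm_ge0 (grad f (theta n)).
split.
  by rewrite (le_trans h1)// ler_pM2l// lerD2r ler_wpM2r.
have : 0 <= (gam k - gam n) * G n ^+ 2 by rewrite mulr_ge0// sqr_ge0.
move: h2; lra.
Qed.

Lemma near_window : \forall n \near \oo, exists m, window alpha t n m.
Proof.
have t2 : 0 < t / 2 by rewrite divr_gt0.
have [N1 _ h] := alpha_0 t2.
near=> n; apply: exists_window_after => // k nk; apply: h => /=.
by rewrite (leq_trans _ nk)//; near: n; exact: nbhs_infty_ge.
Unshelve. all: by end_near. Qed.

Lemma near_noise_small eps : 0 < eps -> \forall n \near \oo, x n <= eps.
Proof.
move=> e0; have r0 : 0 < rho by exact: lt_trans rho_gt1.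
have [s0 _ h] := noise_scale_small B_gt0 r0 e0.
by have := gamma_y s0; apply: filterS => n; exact: h.
Qed.

Lemma near_tail_small eps : 0 < eps -> \forall n \near \oo, gam n * x n <= eps.
Proof.
move=> e0; have r0 : 0 < rho - 1 by rewrite subr_gt0.
have [s0 _ h] := noise_scale_small B_gt0 r0 e0.
near=> n; rewrite noise_scale_time; last first.
  by rewrite (lt_le_trans ltr01)//; near: n; exact: gamma_y.
by apply: h; near: n; exact: gamma_y.
Unshelve. all: by end_near. Qed.

(** [s * noise_scale B rho s], which is of the order of the noise accumulated
    after time [s], decreases over a window by an amount comparable to the
    noise in that window. *)
Lemma near_tail_drop : \forall n \near \oo, forall m, window alpha t n m ->
  (rho - 1) / (4 * (16 * C)) * x n <= gam n * x n - gam m * x m.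
Proof.
near=> n => m [nm /andP[tm1 tm2]].
have g1 : 1 <= gam n by near: n; exact: gamma_y.
have g2 : 2 * rho <= gam n by near: n; exact: gamma_y.
have gn : 0 < gam n by lra.
have gnm : gam n <= gam m by rewrite gamma_mono// ltnW.
have gm : 0 < gam m by lra.
set T := gam m - gam n in tm1 tm2.
have r1 : 0 <= rho - 1 by rewrite subr_ge0 ltW.
have := noise_scale_tangent B_gt0 r1 gm gn.
have -> : noise_scale B (rho - 1) (gam n) = gam n * x n by rewrite noise_scale_time.
have -> : noise_scale B (rho - 1) (gam m) = gam m * x m by rewrite noise_scale_time.
have -> : gam m * x m * (1 - (rho - 1) * ((gam n - gam m) / gam m)) =
    gam m * x m + (rho - 1) * (T * x m).
  by rewrite /T; field; rewrite gt_eqF.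
have xm := noise_scale_tangent B_gt0 rho_ge0 gn gm.
have xn0 := noise_scale_gt0 rho B_gt0 gn.
have half : rho * ((gam m - gam n) / gam n) <= 2^-1.
  rewrite mulrA ler_pdivrMr// -/T.
  have := t_le1; have := rho_gt1; nra.
have xm2 : x n / 2 <= x m by nra.
have T2 : (32 * C)^-1 <= T by apply: le_trans tm1; rewrite -invfM mulrAC -natrM.
have hT : (32 * C)^-1 * (x n / 2) <= T * x m.
  by apply: ler_pM => //; [rewrite invr_ge0 ltW// mulr_gt0 | lra].
have := ler_wpM2l r1 hT.
have -> : (rho - 1) * ((32 * C)^-1 * (x n / 2)) = (rho - 1) / (4 * (16 * C)) * x n.
  by field; rewrite gt_eqF.
lra.
Unshelve. all: by end_near. Qed.

Lemma window_ind (N1 : nat) (P : nat -> nat -> Prop) :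
  (forall n, (N1 <= n)%N -> exists m, window alpha t n m) ->
  (forall n m k, (N1 <= n)%N -> window alpha t n m -> (n <= k <= m)%N -> P n k) ->
  (forall n m k, (N1 <= n)%N -> window alpha t n m -> (m <= k)%N -> P m k -> P n k) ->
  forall n k, (N1 <= n)%N -> (n <= k)%N -> P n k.
Proof.
move=> ex base step n k; move: {2}(k - n)%N (leqnn (k - n)) => i.
elim/ltn_ind: i n => i IH n ki Nn nk.
have [m w] := ex n Nn; have [nm _] := w.
have [km|mk] := leqP k m; first by apply: base Nn w _; rewrite nk.
apply: (step n m k Nn w (ltnW mk)).
apply: (IH (k - m)%N) => //; last exact: ltnW.
- by rewrite (leq_trans _ ki)// ltn_sub2l// (ltn_trans nm).
- exact: leq_trans (ltnW nm).
Qed.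

(** The window estimates make [f (theta n)] plus a multiple of
    [gam n * x n] nonincreasing from window to window. *)
Lemma value_almost_nonincreasing Gmax : (forall n, (N <= n)%N -> G n <= Gmax) ->
  exists2 A, 0 <= A & \forall n \near \oo, forall k, (n <= k)%N ->
    f (theta k) <= f (theta n) + A * (gam n * x n).
Proof.
move=> hG; have r1 : 0 < rho - 1 by rewrite subr_gt0.
have Gmax0 : 0 <= Gmax by rewrite (le_trans (enorm_ge0 _) (hG N _)).
pose A1 := 67 * C / ((rho - 1) / (4 * (16 * C))); pose A2 := 2 * Gmax + 3 * C.
have A1_0 : 0 <= A1 by rewrite /A1 !divr_ge0 ?mulr_ge0 ?(ltW C_gt0) ?(ltW r1).
have A2_0 : 0 <= A2 by rewrite /A2; have := C_gt0; lra.
exists (A1 + A2); first exact: addr_ge0.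
have [N1 _ H] : \forall n \near \oo, [/\ (N <= n)%N, (exists m, window alpha t n m),
    (forall m, window alpha t n m ->
      (rho - 1) / (4 * (16 * C)) * x n <= gam n * x n - gam m * x m),
    x n <= 1 & 1 <= gam n].
  near=> n; split; near: n; [exact: nbhs_infty_ge|exact: near_window|
    exact: near_tail_drop|exact: near_noise_small|exact: gamma_y].
exists N1 => // n /= Nn k nk.
have xg j : (N1 <= j)%N -> 0 <= x j <= gam j * x j.
  move=> /H[_ _ _ _ g1]; have := noise_scale_gt0 rho B_gt0 (lt_le_trans ltr01 g1).
  by move=> /ltW x0; rewrite x0 ler_peMl.
suff : f (theta k) <= f (theta n) + A1 * (gam n * x n) + A2 * (gam n * x n) by lra.
move: n k Nn nk {Gmax0}.
apply: (@window_ind N1) => [n /H[] //|n m k N1n w nk|n m k N1n w mk IH].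
  have [Nn _ _ x1 g1] := H n N1n; have /andP[x0 xgn] := xg n N1n.
  have [_ h] := window_move Nn w nk; have := hG n Nn => hGn.
  have h1 : 0 <= A1 * (gam n * x n) by rewrite mulr_ge0// (le_trans x0).
  have h2 : A2 * x n <= A2 * (gam n * x n) by rewrite ler_wpM2l.
  have h3 : G n * x n <= Gmax * x n by rewrite ler_wpM2r.
  have h4 : C * x n ^+ 2 <= C * x n.
    by rewrite ler_pM2l// expr2 ler_piMl.
  rewrite /A2 in h2 *; lra.
have [Nn _ drop x1 g1] := H n N1n; have /andP[x0 xgn] := xg n N1n.
have dr := drop m w; have wv := window_value Nn w.
have h1 : A1 * ((rho - 1) / (4 * (16 * C)) * x n) = 67 * C * x n.
  by rewrite /A1; field; rewrite !gt_eqF.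
have h2 := ler_wpM2l A1_0 dr.
have h4 : C * x n ^+ 2 <= C * x n.
  by rewrite ler_pM2l// expr2 ler_piMl.
have h5 : 0 <= (8 * (16 * C))^-1 * G n ^+ 2 by rewrite mulr_ge0 ?sqr_ge0 ?ltW.
have h6 : A2 * (gam m * x m) <= A2 * (gam n * x n).
  rewrite ler_wpM2l//.
  have : 0 <= (rho - 1) / (4 * (16 * C)) * x n.
    by rewrite mulr_ge0// divr_ge0 ?ltW// !mulr_gt0.
  lra.
lra.
Unshelve. all: by end_near. Qed.

Local Opaque noise_scale gamma powR enorm.

Section Lojasiewicz.
Variables (a mu M : R).
Local Notation F n := (f (theta n) - a).
Local Notation p := (mu * rho).
Local Notation K := (value_const p C M).
Local Notation K2 := (abs_const p C M).
Hypothesis mu_itv : 1 < mu <= 2.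
Hypothesis M_ge1 : 1 <= M.
Hypothesis loj : forall n, (N <= n)%N -> `|F n| <= M * G n `^ mu.
Hypothesis F_cvg0 : forall eps, 0 < eps -> \forall n \near \oo, `|F n| <= eps.
Hypothesis rho_mu : rho * (2 - mu) < 1 \/ rho * (2 - mu) = 1 /\ 1 <= B.

Let mu_gt0 : 0 < mu. Proof. by case/andP: mu_itv => m1 _; lra. Qed.
Let mu_le2 : mu <= 2. Proof. by case/andP: mu_itv. Qed.
Let M_gt0 : 0 < M. Proof. exact: lt_le_trans M_ge1. Qed.
Let rho_gt0 : 0 < rho. Proof. exact: lt_trans rho_gt1. Qed.
Let p_gt0 : 0 < p. Proof. exact: mulr_gt0. Qed.
Let K_gt0 : 0 < K. Proof. exact: value_const_gt0. Qed.
Let K2_gt0 : 0 < K2. Proof. exact: abs_const_gt0. Qed.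
Local Lemma K_le_K2 : K <= K2. Proof. exact: value_const_le_abs M_gt0 (ltW p_gt0). Qed.

Local Lemma K_ge : 4 * (67 * C) <= K.
Proof.
have h : K / 2 / M <= K.
  rewrite -mulrA -invfM ler_piMr ?(ltW K_gt0)// invf_le1 ?mulr_gt0//.
  by move: M_ge1; lra.
apply: le_trans (le_trans (value_const_ratio_ge p C M_gt0) h); rewrite expr2.
move: C_ge1; nra.
Qed.

Local Notation Q := ((K / 2 / M) `^ (2 / mu)).

Local Lemma Q_ge : 67 * C <= (16 * (16 * C))^-1 * Q.
Proof.
rewrite [leRHS]mulrC ler_pdivlMr ?mulr_gt0//.
rewrite (le_trans _ (value_const_ratio_powR_ge p M_gt0 C_ge1 mu_itv))//.
move: (sqr_ge0 C); lra.
Qed.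

Local Lemma F_step n m : (N <= n)%N -> window alpha t n m ->
  F m <= F n - (8 * (16 * C))^-1 * G n ^+ 2 + 67 * (C * x n ^+ 2).
Proof.
move=> Nn w; rewrite [leRHS](_ : _ =
  f (theta n) - (8 * (16 * C))^-1 * G n ^+ 2 + 67 * (C * x n ^+ 2) - a); last by ring.
by rewrite lerD2r; exact: window_value.
Qed.

(** The Lojasiewicz inequality read backwards, at the scale of the noise. *)
Local Lemma gradient_ge n c : (N <= n)%N -> 0 <= c -> 0 < gam n ->
  c * x n `^ mu <= `|F n| -> (c / M) `^ (2 / mu) * x n ^+ 2 <= G n ^+ 2.
Proof.
move=> Nn c0 g0 h; apply: lojasiewicz_inv => //; last exact: le_trans h (loj Nn).
- by rewrite ltW// noise_scale_gt0.
- exact: enorm_ge0.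
Qed.

Local Notation X s := (noise_scale B rho s).
Local Notation h s := (K * X s `^ mu).

Local Lemma drift c1 c2 : 0 < c1 -> 0 < c2 ->
  (rho * (2 - mu) = 1 -> c1 <= c2) ->
  exists2 s0, 0 < s0 & forall s, s0 <= s -> c1 * (X s `^ mu / s) <= c2 * X s ^+ 2.
Proof.
move=> c10 c20 c12; apply: noise_scale_drift => //.
by case: rho_mu => [|[e B1]]; [left|right; split=> //; exact: c12].
Qed.

(** One step of the comparison of [F] with the supersolution
    [s |-> K * X s ^ mu]. If [F n] is at most half of its bound, the slow
    decay of the bound leaves room for the noise; otherwise the Lojasiewicz
    inequality makes the gradient large and the decrease beats both the noise and
    the decay of the bound. *)
Local Lemma value_step n k s : (N <= n)%N -> window alpha t n k ->
  0 < s -> s <= gam n -> X s <= 1 -> 4 * p <= s ->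
  16 * p * K * (X s `^ mu / s) <= Q * X s ^+ 2 ->
  F n <= h s -> F k <= h (s + (gam k - gam n)).
Proof.
move=> Nn w s0 sg X1 ps hd Fn; have wv := F_step Nn w.
have [nk /andP[_ T2]] := w.
set T := gam k - gam n in T2 *.
have T0 : 0 <= T by rewrite subr_ge0 gamma_mono// ltnW.
have g0 : 0 < gam n by exact: lt_le_trans sg.
have X0 : 0 < X s by exact: noise_scale_gt0.
have xX : x n <= X s by exact: noise_scale_le.
have x0 : 0 < x n by exact: noise_scale_gt0.
have x2 : C * x n ^+ 2 <= C * X s ^+ 2.
  by rewrite ler_pM2l// ler_pXn2r ?nnegrE ?(ltW x0) ?(ltW X0).
have X2 : X s ^+ 2 <= X s `^ mu.
  by rewrite -powR_sqr ?(ltW X0)//; apply: ger_powR; rewrite ?X0.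
have Xmu0 : 0 < X s `^ mu by exact: powR_gt0.
have tang : h s * (1 - p * (T / s)) <= h (s + T).
  have sT0 : 0 < s + T by rewrite ltr_pwDl.
  have := powRN_tangent (ltW p_gt0) sT0 s0.
  rewrite [s + T]addrC addrK => tg.
  rewrite !powR_noise_scale ?(ltW B_gt0)// -[leLHS]mulrA ler_pM2l//.
  by rewrite -[leLHS]mulrA ler_pM2l ?powR_gt0// addrC.
have quarter : p * (T / s) <= 4^-1.
  rewrite mulrA ler_pdivrMr//.
  have pT : p * T <= p by rewrite ler_piMr ?(ltW p_gt0)// (le_trans T2).
  by rewrite (le_trans pT)// ler_pdivlMl.
have h0 : 0 < h s by exact: mulr_gt0.
have CX : 67 * (C * X s ^+ 2) <= 4^-1 * h s.
  have CX' : C * X s ^+ 2 <= C * X s `^ mu by rewrite ler_pM2l.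
  exact: (noise_quarter K_ge CX' (ler0n _ _) (ltW Xmu0)).
have [Fh|Fh] := leP (F n) (h s / 2).
  apply: (supersolution_half wv) tang => //; last exact: ltW.
  - by rewrite mulr_ge0 ?sqr_ge0 ?ltW.
  - by rewrite (le_trans _ CX)// ler_pM2l.
have big : Q * X s ^+ 2 <= G n ^+ 2.
  apply: lojasiewicz_inv => //; rewrite ?(ltW X0) ?enorm_ge0 ?divr_ge0 ?(ltW K_gt0)//.
  rewrite (le_trans _ (loj Nn))// (le_trans _ (ler_norm _))//.
  exact: (mul_half_le Fh).
have dec : (8 * (16 * C))^-1 * (Q * X s ^+ 2) <= (8 * (16 * C))^-1 * G n ^+ 2.
  by rewrite ler_pM2l.
have noi : 67 * (C * X s ^+ 2) <= (16 * (16 * C))^-1 * (Q * X s ^+ 2).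
  by rewrite [leLHS]mulrA [leRHS]mulrA; apply: ler_wpM2r (sqr_ge0 _) _ _ Q_ge.
have drop : h s * (p * (T / s)) <= (16 * (16 * C))^-1 * (Q * X s ^+ 2).
  have -> : h s * (p * (T / s)) = T * (p * K * (X s `^ mu / s)) by ring.
  have q0 : 0 <= p * K * (X s `^ mu / s).
    by rewrite ltW// mulr_gt0// ?divr_gt0// mulr_gt0.
  rewrite (le_trans (ler_wpM2r q0 T2))//.
  have -> : (16 * (16 * C))^-1 = t * 16^-1 by field; rewrite gt_eqF.
  rewrite -[leRHS]mulrA ler_pM2l// ler_pdivlMl//.
  by rewrite (_ : 16 * _ = 16 * p * K * (X s `^ mu / s)); last ring.
have i8 : (8 * (16 * C))^-1 = 2 * (16 * (16 * C))^-1 by field; rewrite gt_eqF.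
apply: (supersolution_drop wv) tang drop => //.
- by rewrite [leLHS]mulrA -i8.
- by rewrite (le_trans _ noi)// ler_pM2l.
Qed.

Local Lemma X_powR_le s u : 0 < s -> s <= u -> X u `^ mu <= X s `^ mu.
Proof.
move=> s0 su; have u0 : 0 < u by exact: lt_le_trans su.
apply: ge0_ler_powR; rewrite ?nnegrE ?(ltW mu_gt0)//; last exact: noise_scale_le.
- by rewrite ltW// noise_scale_gt0.
- by rewrite ltW// noise_scale_gt0.
Qed.

(** The comparison starts at a rank [N1] with the time shifted to
    [s n = gam n - gam N1 + s0]: [s0] is large enough for a step of the
    comparison to be possible, and [N1] is so large that [F] lies below the
    bound as long as [s n <= s0 + t]. Asymptotically [s n] is [gam n]; the factor
    [2 ^ p] comes from [gam n / 2 <= s n]. *)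
Lemma near_value_le : \forall n \near \oo, F n <= K2 * x n `^ mu.
Proof.
have [s1 s1_0 hs1] := noise_scale_small B_gt0 rho_gt0 ltr01.
have c1_0 : 0 < 16 * p * K by rewrite mulr_gt0// mulr_gt0.
have Q0 : 0 < Q by rewrite powR_gt0// !divr_gt0.
have [|s2 s2_0 hs2] := drift c1_0 Q0.
  by move=> e; apply: value_const_critical => //; case/andP: mu_itv.
pose s0 := s1 + s2 + 4 * p.
have p4 : 0 < 4 * p by rewrite mulr_gt0.
have s0_gt0 : 0 < s0 by rewrite !addr_gt0.
have s01 : s1 <= s0 by rewrite /s0 -addrA lerDl addr_ge0// ltW.
have s02 : s2 <= s0 by rewrite /s0 addrAC lerDr addr_ge0// ltW.
have s0p : 4 * p <= s0 by rewrite /s0 lerDr addr_ge0// ltW.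
have s0t : 0 < s0 + t by rewrite addr_gt0.
have h0 : 0 < h (s0 + t) by rewrite mulr_gt0// powR_gt0// noise_scale_gt0.
have [N1 _ HN1] : \forall n \near \oo,
    [/\ (N <= n)%N, s0 <= gam n, alpha n <= t / 2 & `|F n| <= h (s0 + t)].
  near=> n; split; near: n; [exact: nbhs_infty_ge|exact: gamma_y| |exact: F_cvg0].
  by apply: alpha_0; rewrite divr_gt0.
pose s n := gam n - gam N1 + s0.
have s_ge n : (N1 <= n)%N -> s0 <= s n.
  by move=> n1; rewrite /s lerDr subr_ge0 gamma_mono.
have claim k : (N1 <= k)%N -> F k <= h (s k).
  elim/ltn_ind: k => k IH N1k; have [_ _ _ Fk] := HN1 k N1k.
  have [kt|kt] := leP (gam k - gam N1) t.
    apply: le_trans (ler_norm _) _; apply: le_trans Fk _.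
    rewrite (ler_pM2l K_gt0); apply: X_powR_le.
      exact: lt_le_trans s0_gt0 (s_ge k N1k).
    by rewrite /s addrC lerD2l.
  have at2 n : (N1 <= n)%N -> alpha n <= t / 2 by move=> /HN1[].
  have [n [N1n w]] := exists_window_before alpha_gt0 at2 t_gt0 kt.
  have [Nn _ _ _] := HN1 n N1n; have [nk _] := w.
  have sn : s0 <= s n by exact: s_ge.
  have -> : s k = s n + (gam k - gam n) by rewrite /s; ring.
  have X1 : X (s n) <= 1 by apply: hs1; exact: le_trans sn.
  have hd : 16 * p * K * (X (s n) `^ mu / s n) <= Q * X (s n) ^+ 2.
    by apply: hs2; exact: le_trans sn.
  have sg : s n <= gam n.
    have [_ s0N1 _ _] := HN1 N1 (leqnn N1).
    by rewrite /s -addrA gerDl addrC subr_le0.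
  exact: (value_step Nn w (lt_le_trans s0_gt0 sn) sg X1 (le_trans s0p sn) hd
    (IH n nk N1n)).
near=> n.
have N1n : (N1 <= n)%N by near: n; exact: nbhs_infty_ge.
have g2 : 2 * gam N1 + 1 <= gam n by near: n; exact: gamma_y.
have gN1 := gamma_ge0 alpha_gt0 N1.
have gn : 0 < gam n by rewrite (lt_le_trans _ g2)// ltr_wpDl// mulr_ge0.
have gs : gam n / 2 <= s n.
  rewrite /s ler_pdivrMr// mulrC mulrDr mulrBr -subr_ge0.
  rewrite (_ : _ - _ = gam n - (2 * gam N1 + 1) + (2 * s0 + 1)); last by ring.
  by rewrite addr_ge0 ?subr_ge0// addr_ge0// mulr_ge0// ltW.
apply: le_trans (claim n N1n) _.
have g20 : 0 < gam n / 2 by rewrite divr_gt0.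
have hs : h (s n) <= h (gam n / 2) by rewrite (ler_pM2l K_gt0); exact: X_powR_le.
apply: le_trans hs _; rewrite /abs_const.
rewrite !powR_noise_scale ?(ltW B_gt0)// powRM ?(ltW gn)// -(powR_inv1 (ler0n _ 2)).
rewrite -powRrM mulrNN mul1r le_eqVlt; apply/orP; left; apply/eqP; ring.
Unshelve. all: by end_near. Qed.

Local Lemma noise_le_decrease n : (N <= n)%N -> 0 < gam n -> K / 2 * x n `^ mu <= `|F n| ->
  67 * (C * x n ^+ 2) <= (8 * (16 * C))^-1 * G n ^+ 2.
Proof.
move=> Nn gn hF; have c0 : 0 <= K / 2 by rewrite divr_ge0// ltW.
have big := gradient_ge Nn c0 gn hF.
have i8 : (8 * (16 * C))^-1 = 2 * (16 * (16 * C))^-1 by field; rewrite gt_eqF.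
have h1 : (8 * (16 * C))^-1 * (Q * x n ^+ 2) <= (8 * (16 * C))^-1 * G n ^+ 2.
  by rewrite ler_pM2l.
apply: le_trans h1; rewrite [leLHS]mulrA [leRHS]mulrA ler_wpM2r ?sqr_ge0//.
apply: le_trans Q_ge _; apply: ler_wpM2r (powR_ge0 _ _) _ _ _.
by rewrite i8 ler_peMl ?ler1n// invr_ge0 ltW// !mulr_gt0.
Qed.

(** A value of [F] below [- K * x n ^ mu] could never be recovered: the gradient
    would stay so large that [F] decreases over all later windows, and [F] would
    not tend to [0]. *)
Lemma near_value_ge : \forall n \near \oo, - (K * x n `^ mu) <= F n.
Proof.
have [N1 _ HN1] : \forall n \near \oo,
    [/\ (N <= n)%N, exists m, window alpha t n m & 1 <= gam n].
  near=> n; split; near: n; [exact: nbhs_infty_ge|exact: near_window|exact: gamma_y].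
exists N1 => // n /= N1n; rewrite leNgt; apply/negP => Fn.
have [_ _ gn1] := HN1 n N1n.
have gn : 0 < gam n by exact: lt_le_trans gn1.
have xn0 : 0 < K * x n `^ mu by rewrite mulr_gt0// powR_gt0// noise_scale_gt0.
have Fn0 : F n < 0 by rewrite (lt_le_trans Fn)// oppr_le0 ltW.
have step k : (n <= k)%N -> F k <= F n -> exists m, (k < m)%N /\ F m <= F n.
  move=> nk Fk; have [Nk [m w] gk1] := HN1 k (leq_trans N1n nk).
  have [km _] := w; exists m; split=> //; apply: (le_trans _ Fk).
  apply: le_trans (F_step Nk w) _; rewrite -addrA gerDl addrC subr_le0.
  apply: noise_le_decrease => //; first exact: lt_le_trans gk1.
  have xk : x k `^ mu <= x n `^ mu by rewrite X_powR_le// gamma_mono.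
  have xk0 : 0 <= x k `^ mu by exact: powR_ge0.
  rewrite ler0_norm; last by rewrite (le_trans Fk (ltW Fn0)).
  rewrite lerNr; apply: (le_trans Fk); apply: (le_trans (ltW Fn)); rewrite lerN2.
  have h1 : K * x k `^ mu <= K * x n `^ mu by rewrite (ler_pM2l K_gt0); exact: xk.
  apply: (le_trans _ h1); apply: (ler_wpM2r xk0).
  by rewrite ler_pdivrMr// ler_peMr ?(ltW K_gt0)// ler1n.
have [N2 _ HN2] : \forall k \near \oo, `|F k| <= - F n / 2.
  by apply: F_cvg0; rewrite divr_gt0// oppr_gt0.
have [k [N2k nk Fk]] := chain_cofinal step (leqnn n) (lexx _) N2.
have := HN2 k N2k; rewrite (ler0_norm (le_trans Fk (ltW Fn0))) => Fk2.
by apply: (half_neg_absurd Fn0); apply: (le_trans _ Fk2); rewrite lerN2.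
Unshelve. all: by end_near. Qed.

Lemma near_value_abs : \forall n \near \oo, `|F n| <= K2 * x n `^ mu.
Proof.
near=> n; rewrite ler_norml; apply/andP; split; last by near: n; exact: near_value_le.
rewrite (@le_trans _ _ (- (K * x n `^ mu)))//; last by near: n; exact: near_value_ge.
by rewrite lerN2; apply: ler_wpM2r (powR_ge0 _ _) _ _ K_le_K2.
Unshelve. all: by end_near. Qed.

Lemma near_gradient_le : \forall n \near \oo,
  G n ^+ 2 <= grad_const p C M * x n `^ mu.
Proof.
have [N1 _ HN1] : \forall n \near \oo, [/\ (N <= n)%N, exists m, window alpha t n m,
     1 <= gam n, x n <= 1 & `|F n| <= K2 * x n `^ mu].
  near=> n; split; near: n; [exact: nbhs_infty_ge|exact: near_window|exact: gamma_y
    |exact: near_noise_small|exact: near_value_abs].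
exists N1 => // n /= N1n; have [Nn [m w] gn1 x1 Fn] := HN1 n N1n.
have gn : 0 < gam n by exact: lt_le_trans gn1.
have [nm _] := w; have [_ _ _ _ Fm] := HN1 m (leq_trans N1n (ltnW nm)).
have xm : K2 * x m `^ mu <= K2 * x n `^ mu.
  by rewrite (ler_pM2l K2_gt0); apply: X_powR_le gn _; apply: gamma_mono => //; exact: ltnW.
have x0 : 0 < x n by exact: noise_scale_gt0.
have x2 : C * x n ^+ 2 <= C * x n `^ mu.
  by rewrite ler_pM2l// -powR_sqr ?(ltW x0)//; apply: ger_powR; rewrite ?x0.
have c0 : 0 < 8 * (16 * C) by rewrite !mulr_gt0.
rewrite /grad_const -[leRHS]mulrA -(ler_pdivrMl _ _ c0).
exact: (gradient_step (F_step Nn w) Fn (le_trans Fm xm) x2).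
Unshelve. all: by end_near. Qed.

(** The potential [W n = F n / x n + c * (gam n * x n)] drops over each window by
    at least one eighth of the displacement: [G <= G ^ 2 / x + x], and up to
    constants the first term is the drop of [F / x] and the second one the drop of
    [gam * x]. As [W] tends to [0], it bounds all later displacements. *)
Lemma near_distance_le : \forall n \near \oo, forall k, (n <= k)%N ->
  enorm (theta k - theta n) <=
  8 * (K2 + dist_const rho p C M) * (gam n * x n).
Proof.
set c := dist_const rho p C M.
have r1 : 0 < rho - 1 by rewrite subr_gt0.
have c_gt0 : 0 < c.
  rewrite /c /dist_const mulr_gt0 ?divr_gt0 ?mulr_gt0//.
  by rewrite addr_gt0// addr_gt0// mulr_gt0.
have cE : c * ((rho - 1) / (4 * (16 * C))) = 67 * C + rho * K2 + 1.
  by rewrite /c /dist_const; field; rewrite !gt_eqF.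
have [s0 s00 hs0] := drift ltr01 ltr01 (fun _ => lexx _).
have [N1 _ HN1] : \forall n \near \oo, [/\ (N <= n)%N, exists m, window alpha t n m,
    s0 + 1 <= gam n, `|F n| <= K2 * x n `^ mu & forall m, window alpha t n m ->
     (rho - 1) / (4 * (16 * C)) * x n <= gam n * x n - gam m * x m].
  near=> n; split; near: n; [exact: nbhs_infty_ge|exact: near_window|exact: gamma_y
    |exact: near_value_abs|exact: near_tail_drop].
have gam1 n : (N1 <= n)%N -> 1 <= gam n.
  by move=> /HN1[_ _ gs _ _]; rewrite (le_trans _ gs)// lerDr ltW.
have gam0 n : (N1 <= n)%N -> 0 < gam n by move=> /gam1; exact: lt_le_trans.
have x0 n : (N1 <= n)%N -> 0 < x n by move=> /gam0; exact: noise_scale_gt0.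
have xmu n : (N1 <= n)%N -> x n `^ mu / gam n <= x n ^+ 2.
  move=> N1n; have [_ _ gs _ _] := HN1 n N1n.
  have := hs0 (gam n); rewrite !mul1r; apply.
  by rewrite (le_trans _ gs)// lerDl.
pose W n := F n / x n + c * (gam n * x n).
have Fx n : (N1 <= n)%N -> `|F n| / x n <= K2 * (gam n * x n).
  move=> N1n; have [_ _ _ Fn _] := HN1 n N1n.
  rewrite (ler_pdivrMr _ _ (x0 n N1n)); apply: (le_trans Fn).
  rewrite -[leRHS]mulrA (ler_pM2l K2_gt0) -[leRHS]mulrA -expr2 [leRHS]mulrC.
  by rewrite -(ler_pdivrMr _ _ (gam0 n N1n)); exact: xmu.
have W_le n : (N1 <= n)%N -> W n <= (K2 + c) * (gam n * x n).
  move=> N1n; rewrite [leRHS]mulrDl lerD2r; apply: (le_trans _ (Fx n N1n)).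
  by rewrite ler_pM2r ?invr_gt0 ?x0// ler_norm.
have W_ge n : (N1 <= n)%N -> - (K2 * (gam n * x n)) <= W n.
  move=> N1n; apply: (@le_trans _ _ (F n / x n)); last first.
    by rewrite lerDl ltW// mulr_gt0// mulr_gt0 ?gam0 ?x0.
  rewrite lerNl; apply: (le_trans _ (Fx n N1n)).
  by rewrite -mulNr ler_pM2r ?invr_gt0 ?x0// -normrN ler_norm.
have W_step n m k : (N1 <= n)%N -> window alpha t n m -> (n <= k <= m)%N ->
    enorm (theta k - theta n) <= 8 * (W n - W m).
  move=> N1n w nk; have [Nn _ _ Fn drop] := HN1 n N1n.
  have [nm /andP[_ T2]] := w; have N1m := leq_trans N1n (ltnW nm).
  have [_ _ _ Fm _] := HN1 m N1m.
  have [mv _] := window_move Nn w nk.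
  have gnm : gam n <= gam m by rewrite gamma_mono// ltnW.
  have T0 : 0 <= gam m - gam n by rewrite subr_ge0.
  have t12 : t <= 2^-1.
    rewrite lef_pV2 ?posrE ?mulr_gt0//.
    by apply: (@le_trans _ _ 16); [rewrite ler_nat|rewrite ler_peMr].
  have Th := le_trans T2 t12.
  have Tg : gam m - gam n <= gam n.
    by rewrite (le_trans Th)// (le_trans _ (gam1 n N1n))// invf_le1 ?ler1n.
  have tang := noise_scale_tangent B_gt0 rho_ge0 (gam0 n N1n) (gam0 m N1m).
  have gE : gam m = gam n + (gam m - gam n) by rewrite addrC subrK.
  have xnm : x m <= x n by rewrite noise_scale_le// gam0.
  have q := quotient_step (x0 n N1n) (x0 m N1m) xnm (gam0 n N1n) gE Tg T0 Th rho_ge0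
    (ltW K2_gt0) (F_step Nn w) Fm (xmu m N1m) tang.
  have DE : (8 * (16 * C))^-1 * G n ^+ 2 = t / 8 * G n ^+ 2.
    by congr (_ * _); field; rewrite gt_eqF.
  have mv2 := move_step (x0 n N1n) (ltW t_gt0) t_le1 DE.
  apply: (le_trans mv); apply: (le_trans mv2); rewrite ler_pM2l//.
  have dr := ler_wpM2l (ltW c_gt0) (drop m w).
  rewrite [leLHS]mulrA cE in dr.
  exact: (potential_drop q dr).
have W_ge0 n : (N1 <= n)%N -> 0 <= W n.
  move=> N1n; rewrite leNgt; apply/negP => Wn.
  have step k : (n <= k)%N -> W k <= W n -> exists m, (k < m)%N /\ W m <= W n.
    move=> nk Wk; have [_ [m w] _ _ _] := HN1 k (leq_trans N1n nk).
    have [km _] := w; exists m; split=> //; apply: (le_trans _ Wk).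
    have kk : (k <= k <= m)%N by rewrite leqnn ltnW.
    have := W_step k m k (leq_trans N1n nk) w kk.
    by rewrite subrr enorm0 pmulr_rge0// subr_ge0.
  have e0 : 0 < - W n / (2 * K2) by apply: divr_gt0; [rewrite oppr_gt0|exact: mulr_gt0].
  have [N2 _ HN2] := near_tail_small e0.
  have [k [N2k nk Wk]] := chain_cofinal step (leqnn n) (lexx _) N2.
  have K20 : 0 < 2 * K2 by exact: mulr_gt0.
  have := HN2 k N2k; rewrite (ler_pdivlMr _ _ K20) => small.
  have := W_ge k (leq_trans N1n nk).
  exact: (negative_potential K2_gt0 Wn Wk small).
exists N1 => // n /= N1n k nk.
rewrite -mulrA; apply: (@le_trans _ _ (8 * W n)); last first.
  by rewrite ler_pM2l//; exact: W_le.
move: n k N1n nk; apply: (@window_ind N1) => [n /HN1[]//|n m k N1n w nk|n m k N1n w mk IH].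
  have [nm _] := w; apply: (le_trans (W_step n m k N1n w nk)); rewrite ler_pM2l//.
  by rewrite gerBl W_ge0// (leq_trans N1n)// ltnW.
have [nm _] := w; have nmm : (n <= m <= m)%N by rewrite leqnn ltnW.
apply: (le_trans (enorm_dist_triangle (theta m) _ _)).
apply: (le_trans (lerD IH (W_step n m m N1n w nmm))).
by rewrite -mulrDr addrC subrK.
Unshelve. all: by end_near. Qed.

End Lojasiewicz.

End Rate.

(** * From the averaged noise to the noise in a window *)

Section NoiseWindows.
Context {R : realType} {d : nat}.
Variables (alpha : nat -> R) (xi : nat -> 'rV[R]_d).
Hypothesis alpha_gt0 : forall n, 0 < alpha n.
Local Notation gam := (gamma alpha).
Hypothesis gamma_y : forall A, \forall n \near \oo, A <= gam n.

Lemma le_awin n k (t : R) : (n <= k)%N -> gam k - gam n <= t ->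
  (k <= awin alpha n t)%N.
Proof.
move=> nk kt; pose P j := (n <= j)%N && (gam j - gam n <= t).
have Pk : P k by rewrite /P nk kt.
have [N _ /(_ N (leqnn N)) hN] := gamma_y (gam n + t + 1).
have ub j : P j -> (j <= N)%N.
  case/andP => nj jt; rewrite leqNgt; apply/negP => /ltnW /(gamma_mono alpha_gt0).
  lra.
have [m /andP[nm mt] maxm] := ex_maxnP (ex_intro _ k Pk) ub.
have := @xgetPex nat n [set k | aset alpha n t k /\
  forall j, aset alpha n t j -> (j <= k)%N].
rewrite -/(awin alpha n t) => /(_ _)[|_ max]; last exact: max.
exists m; split=> [//|j [nj jt]].
by apply: maxm; rewrite /P nj jt.
Qed.

Lemma weighted_sum_le_noise_max (r t : R) n j : (n <= j)%N -> gam j - gam n <= t ->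
  enorm (\sum_(n <= i < j) (alpha i * gam i `^ r) *: xi i) <=
  noise_max alpha r xi t n.
Proof.
move=> nj jt; rewrite /noise_max; have := le_awin nj jt.
case: j nj {jt} => [|j] nj jw.
  by rewrite big_geq// enorm0 bigmax_ge_id.
have [nj'|nj'] := leqP n j; last first.
  by rewrite big_geq// enorm0 bigmax_ge_id.
pose F k := enorm (\sum_(n <= i < k.+1) (alpha i * gam i `^ r) *: xi i).
have jr : j \in index_iota n (awin alpha n t) by rewrite mem_index_iota nj'.
exact: (@Order.TotalTheory.le_bigmax_seq _ _ _ _ 0 j xpredT F jr isT).
Qed.

(** Summation by parts: weights that decrease only improve a bound on partial
    sums. *)
Lemma enorm_abel_le (w : nat -> R) (u : nat -> 'rV[R]_d) (c : R) n J :
  (forall i, (n <= i)%N -> 0 <= w i.+1 <= w i) -> 0 <= c -> (n <= J)%N ->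
  (forall j, (n <= j <= J)%N -> enorm (\sum_(n <= i < j) u i) <= c) ->
  enorm (\sum_(n <= i < J) w i *: u i) <= w n * c.
Proof.
move=> hw c0 nJ hu; pose Sm j := \sum_(n <= i < j) u i.
have key j : (n <= j <= J)%N ->
    enorm (\sum_(n <= i < j) w i *: u i - w j *: Sm j) <= (w n - w j) * c.
  elim: j => [|j IH] /andP[nj jJ].
    have -> : n = 0%N by apply/eqP; rewrite -leqn0.
    by rewrite /Sm !big_geq// scaler0 subrr enorm0 subrr mul0r.
  move: nj; rewrite leq_eqVlt => /predU1P[<-|nj].
    by rewrite /Sm !big_geq// scaler0 subrr enorm0 subrr mul0r.
  have -> : \sum_(n <= i < j.+1) w i *: u i - w j.+1 *: Sm j.+1 =
      (\sum_(n <= i < j) w i *: u i - w j *: Sm j) + (w j - w j.+1) *: Sm j.+1.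
    by rewrite /Sm !big_nat_recr//=; apply/rowP => k; rewrite !mxE; ring.
  have /andP[w0 wj] := hw j nj.
  apply: (le_trans (enormD _ _)).
  have -> : (w n - w j.+1) * c = (w n - w j) * c + (w j - w j.+1) * c by ring.
  rewrite enormZ ger0_norm ?subr_ge0//; apply: lerD.
    by apply: IH; rewrite [(n <= j)%N]nj ltnW.
  by rewrite ler_wpM2l ?subr_ge0// hu// jJ andbT ltnW.
have nJJ : (n <= J <= J)%N by rewrite nJ leqnn.
have -> : \sum_(n <= i < J) w i *: u i =
    (\sum_(n <= i < J) w i *: u i - w J *: Sm J) + w J *: Sm J by rewrite subrK.
apply: (le_trans (enormD _ _)); rewrite enormZ.
have wJ : 0 <= w J by have /andP[w0 wJ] := hw J nJ; exact: le_trans wJ.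
rewrite (ger0_norm wJ).
have := lerD (key J nJJ) (ler_wpM2l wJ (hu J nJJ)); rewrite -/(Sm J).
by rewrite -mulrDl subrK.
Qed.

(** The weights [gam i ^ (- r)] undo the normalization of the averaged noise. *)
Lemma noise_window_le (r c : R) : 0 <= r -> 0 <= c ->
  (\forall n \near \oo, noise_max alpha r xi 1 n <= c) ->
  \forall n \near \oo, forall j, (n <= j)%N -> gam j - gam n <= 1 ->
    enorm (\sum_(n <= i < j) alpha i *: xi i) <= noise_scale c r (gam n).
Proof.
move=> r0 c0 hc; near=> n => j nj j1.
have g1 : 1 <= gam n by near: n; exact: gamma_y.
have gpos i : (n <= i)%N -> 0 < gam i.
  by move=> /(gamma_mono alpha_gt0) ni; rewrite (lt_le_trans ltr01)// (le_trans g1).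
have -> : \sum_(n <= i < j) alpha i *: xi i =
    \sum_(n <= i < j) gam i `^ (- r) *: ((alpha i * gam i `^ r) *: xi i).
  rewrite big_nat_cond [RHS]big_nat_cond; apply: eq_bigr => i /[!andbT] /andP[ni _].
  rewrite scalerA powRN mulrCA mulVf ?mulr1// gt_eqF// powR_gt0//; exact: gpos.
rewrite /noise_scale mulrC.
apply: (@enorm_abel_le (fun i => gam i `^ (- r))) => // [i ni|k /andP[nk kj]].
  by rewrite powR_ge0 powRN_le ?gpos// gamma_mono.
have k1 : gam k - gam n <= 1 by rewrite (le_trans _ j1)// lerD2r gamma_mono.
rewrite (le_trans (weighted_sum_le_noise_max r nk k1))//.
by near: n.
Unshelve. all: by end_near. Qed.

(** This is where a noise with [r > 1 / (2 - mu)] becomes negligible. *)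
Lemma noise_scale_weaken (r rho c B : R) : 0 <= c -> 0 < B ->
  rho < r \/ rho = r /\ c <= B ->
  \forall n \near \oo, noise_scale c r (gam n) <= noise_scale B rho (gam n).
Proof.
move=> c0 B0 [rr|[<- cB]]; last first.
  by near=> n; rewrite ler_wpM2r// powR_ge0.
have k0 : 0 < r - rho by rewrite subr_gt0.
have e0 : 0 < B / (c + 1) by rewrite divr_gt0// ltr_wpDl.
have [s0 s00 hs] := powRN_small k0 e0.
near=> n; have gn : s0 <= gam n by near: n; exact: gamma_y.
have g0 : 0 < gam n by exact: lt_le_trans gn.
have -> : noise_scale c r (gam n) = c * gam n `^ (- (r - rho)) * gam n `^ (- rho).
  rewrite /noise_scale -mulrA -powRD ?(gt_eqF g0) ?implybT//.
  by congr (_ * _ `^ _); ring.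
rewrite ler_wpM2r ?powR_ge0// (le_trans (ler_wpM2l c0 (hs _ gn)))//.
rewrite mulrA ler_pdivrMr ?ltr_wpDl// mulrC ler_wpM2l ?(ltW B0)//.
by rewrite lerDl.
Unshelve. all: by end_near. Qed.

End NoiseWindows.

(** * Compactness and almost monotone sequences *)

Section Compactness.
Context {R : realType} {d : nat}.

Lemma near_eball (x : 'rV[R]_d) e : 0 < e -> \forall y \near x, eball x e y.
Proof.
move=> e0; have d0 : 0 < e / (d%:R + 1) by rewrite divr_gt0// ltr_wpDl.
apply: filterS (nbhsx_ballx x _ d0) => y; rewrite -ball_normE /= distrC => /ltW.
rewrite ler_pdivlMr ?ltr_wpDl// => h; rewrite /eball /= (le_trans (enorm_le_normr _))//.
by apply: le_trans h; rewrite mulrC ler_wpM2l// lerDl.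
Qed.

Lemma enorm_dist_continuous (x : 'rV[R]_d) : continuous (fun y : 'rV[R]_d => enorm (y - x)).
Proof.
move=> y; apply/(@cvgrPdist_le R R _ (nbhs y) (nbhs_filter y)) => e e0.
apply: filterS (near_eball y e0) => z; rewrite /eball /= => zy; rewrite ler_norml.
have h1 := enorm_dist_triangle y z x; have h2 := enorm_dist_triangle z y x.
rewrite (enormBC y z) in h2; lra.
Qed.

Lemma closed_eball (x : 'rV[R]_d) e : closed (eball x e).
Proof.
have -> : eball x e = (fun y => enorm (y - x)) @^-1` [set z | z <= e] by [].
by apply: closed_comp; [move=> y _; exact: enorm_dist_continuous|exact: closed_le].
Qed.

Lemma compact_eball (x : 'rV[R]_d) e : compact (eball x e).
Proof.
apply: bounded_closed_compact; last exact: closed_eball.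
  exists (`|x| + e); split; first exact: num_real.
  move=> b hb y; rewrite /eball /= => yx; apply: le_trans (ltW hb).
  rewrite -[y](subrK x) (le_trans (ler_normD _ _))// addrC lerD2l.
  by rewrite (le_trans (normr_le_enorm _)).
Qed.

(** A constant works near each pair of points of the compact set: near the
    diagonal this is the local Lipschitz constant, off the diagonal the distance
    of the points is bounded below. *)
Lemma lipschitz_on_compact (g : 'rV[R]_d -> 'rV[R]_d) (K : set 'rV[R]_d) :
  locally_elipschitz g -> compact K -> exists2 L, 1 <= L & elipschitz_on L K g.
Proof.
move=> lg cK; have cKK := compact_setX cK cK.
pose P (L : R) (z : 'rV[R]_d * 'rV[R]_d) :=
  enorm (g z.1 - g z.2) <= L * enorm (z.1 - z.2).
have near1 (x y : 'rV[R]_d) e : 0 < e -> \forall z \near (x, y), eball x e z.1.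
  move=> e0; exists (eball x e, setT) => [|[z1 z2] []//].
  by split; [exact: near_eball|exact: filterT].
have near2 (x y : 'rV[R]_d) e : 0 < e -> \forall z \near (x, y), eball y e z.2.
  move=> e0; exists (setT, eball y e) => [|[z1 z2] []//].
  by split; [exact: filterT|exact: near_eball].
have [|L0 [_ hL0]] := (compact_near_coveringP _).1 cKK R +oo P _.
  move=> [x y] _.
  have [ex [Lx [ex0 hx]]] := lg x; have [ey [Ly [ey0 hy]]] := lg y.
  have [xy|xy] := eqVneq x y.
    subst y; exists ([set z | eball x ex z.1 /\ eball x ex z.2], [set L | Lx <= L]).
      by split; [apply: filterI; [exact: near1|exact: near2]|exact/nbhs_pinfty_ge/num_real].
    move=> [z L] [[/= z1 z2] LL]; rewrite /P.
    by rewrite (le_trans (hx _ _ z1 z2))// ler_wpM2r ?enorm_ge0.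
  have e0 : 0 < enorm (x - y).
    by rewrite (lt_le_trans _ (normr_le_enorm _))// normr_gt0 subr_eq0.
  pose e := enorm (x - y) / 4.
  have e4 : 0 < e by rewrite divr_gt0.
  pose A := `|Lx| * ex + enorm (g x - g y) + `|Ly| * ey.
  have A0 : 0 <= A by rewrite !addr_ge0 ?mulr_ge0 ?enorm_ge0// ltW.
  exists ([set z | (eball x ex z.1 /\ eball y ey z.2) /\ (eball x e z.1 /\ eball y e z.2)],
    [set L | A / (2 * e) <= L]).
    split; last exact/nbhs_pinfty_ge/num_real.
    by do 2?apply: filterI; first [exact: near1|exact: near2].
  move=> [z L] [[/= [z1 z2] [z1' z2']] LA]; rewrite /P.
  have far : 2 * e <= enorm (z.1 - z.2).
    have h1 := enorm_dist_triangle z.1 x y; have h2 := enorm_dist_triangle z.2 z.1 y.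
    move: z1' z2' h1 h2; rewrite /eball /= (enormBC z.1 x) => z1' z2' h1 h2.
    have eE : enorm (x - y) = 4 * e by rewrite /e; field.
    lra.
  have bound : enorm (g z.1 - g z.2) <= A.
    have x0 : eball x ex x by rewrite /eball /= subrr enorm0 ltW.
    have y0 : eball y ey y by rewrite /eball /= subrr enorm0 ltW.
    have h1 := hx _ _ z1 x0; have h2 := hy _ _ y0 z2.
    have h3 : Lx * enorm (z.1 - x) <= `|Lx| * ex.
      rewrite (le_trans (ler_norm _))// normrM (ger0_norm (enorm_ge0 _)).
      by rewrite ler_wpM2l.
    have h4 : Ly * enorm (y - z.2) <= `|Ly| * ey.
      rewrite (le_trans (ler_norm _))// normrM (ger0_norm (enorm_ge0 _)).
      by rewrite ler_wpM2l// enormBC.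
    have h5 := enorm_dist_triangle (g x) (g z.1) (g z.2).
    have h6 := enorm_dist_triangle (g y) (g x) (g z.2).
    by rewrite /A; lra.
  apply: (le_trans bound).
  have e2 : 0 < 2 * e by exact: mulr_gt0.
  have AE : A = A / (2 * e) * (2 * e) by rewrite divfK// gt_eqF.
  by rewrite [leLHS]AE ler_pM// ?divr_ge0// ltW.
exists (Num.max (L0 + 1) 1); first by rewrite le_max lexx orbT.
move=> x y Kx Ky; apply: (hL0 _ _ (x, y)) => //.
by rewrite lt_max ltrDl ltr01.
Qed.

End Compactness.

(** The limit is the infimum of [u n + e n], which bounds all later values. *)
Lemma almost_nonincreasing_cvg {R : realType} (u e : nat -> R) (m : R) :
  (forall eps, 0 < eps -> \forall n \near \oo, e n <= eps) ->
  (\forall n \near \oo, forall k, (n <= k)%N -> u k <= u n + e n) ->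
  (forall n, m <= u n) ->
  exists a, forall eps, 0 < eps -> \forall n \near \oo, `|u n - a| <= eps.
Proof.
move=> he [N _ hu] um.
pose E := [set u n + e n | n in [set n | (N <= n)%N]].
have E0 : E !=set0 by exists (u N + e N); exists N => /=.
have lbE : has_lbound E.
  exists m => _ [n /= Nn <-]; rewrite (le_trans (um n))//.
  exact: hu.
exists (inf E) => eps eps0.
have [_ [n /= Nn <-] hn] := inf_adherent eps0 (conj E0 lbE).
near=> k; rewrite ler_distl; apply/andP; split.
  have ek : e k <= eps by near: k; exact: he.
  have Nk : (N <= k)%N by near: k; exact: nbhs_infty_ge.
  have : inf E <= u k + e k by apply: ge_inf => //; exists k.
  lra.
apply: (le_trans _ (ltW hn)); apply: hu => //.
by near: k; exact: nbhs_infty_ge.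
Unshelve. all: by end_near. Qed.

(** * Exponents and upper limits *)

(** The three regimes of the theorem, stated without extended reals: [rho * (2 - mu)]
    is compared with [1]. *)
Lemma min_rP {R : realType} (r mu : R) : 1 < r -> 1 < mu <= 2 ->
  1 < Defs.min_r r mu /\
  [\/ [/\ (r%:E < r_of mu)%E, Defs.min_r r mu = r & r * (2 - mu) < 1],
      [/\ r%:E = r_of mu, Defs.min_r r mu = r & r * (2 - mu) = 1] |
      [/\ (r_of mu < r%:E)%E, Defs.min_r r mu < r & Defs.min_r r mu * (2 - mu) = 1]].
Proof.
move=> r1 /andP[mu1 mu2]; rewrite /Defs.min_r /r_of.
case: ifPn => [mu2'|]; last first.
  rewrite -leNgt => mu2'; have -> : mu = 2 by apply/eqP; rewrite eq_le mu2 mu2'.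
  rewrite min_l ?leey//=; split=> //; apply: Or31; split=> //; first exact: ltry.
  by rewrite subrr mulr0.
have m0 : 0 < 2 - mu by rewrite subr_gt0.
have i1 : 1 < (2 - mu)^-1 by rewrite invf_gt1// ltrBlDr ltrD2l.
have [h|h|h] := ltgtP r (2 - mu)^-1.
- rewrite min_l ?lee_fin ?(ltW h)//=; split=> //; apply: Or31; split=> //.
  by rewrite -ltr_pdivlMr// div1r.
- rewrite min_r ?lee_fin ?(ltW h)//=; split=> //; apply: Or33; split=> //.
  by rewrite mulVf// gt_eqF.
- rewrite min_l ?lee_fin ?h//=; split=> //; apply: Or32; split=> //.
  by rewrite mulVf// gt_eqF.
Qed.

Section UpperLimits.
Context {R : realType}.
Implicit Types (u : nat -> R) (c : R).

Lemma near_le_of_limn_esup_lt u c : (limn_esup (fun n => (u n)%:E) < c%:E)%E ->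
  \forall n \near \oo, u n <= c.
Proof.
move=> /ereal_inf_lt[_ [V FV <-] hV]; apply: filterS FV => n Vn.
by rewrite -lee_fin ltW// (le_lt_trans _ hV)//; apply: ereal_sup_ubound; exists n.
Qed.

Lemma limn_esup_le_of_near u c : (\forall n \near \oo, u n <= c) ->
  (limn_esup (fun n => (u n)%:E) <= c%:E)%E.
Proof.
move=> h; apply: (@le_trans _ _ (ereal_sup ((fun n => (u n)%:E) @` [set n | u n <= c]))).
  by apply: ereal_inf_lbound; exists [set n | u n <= c].
by apply: ge_ereal_sup => _ [n /= un <-]; rewrite lee_fin.
Qed.

Lemma limn_esup_ge0 u : (forall n, 0 <= u n) -> (0 <= limn_esup (fun n => (u n)%:E))%E.
Proof.
move=> u0; apply: limf_esup_ge0 => [|n]; last by rewrite lee_fin.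
exact: filter_not_empty.
Qed.

End UpperLimits.

(** * Convergence and rates along a bounded trajectory *)

Section Trajectory.
Context {R : realType} {d : nat}.
Variables (f : 'rV[R]_d -> R) (alpha : nat -> R) (theta xi : nat -> 'rV[R]_d) (r : R).
Hypothesis f_diff : forall x, differentiable f x.
Hypothesis grad_lip : locally_elipschitz (grad f).
Hypothesis alpha_gt0 : forall n, 0 < alpha n.
Hypothesis theta_rec : forall n,
  theta n.+1 = theta n - alpha n *: (grad f (theta n) + xi n).
Local Notation gam := (gamma alpha).
Hypothesis gamma_y : forall A, \forall n \near \oo, A <= gam n.
Hypothesis alpha_0 : forall eps, 0 < eps -> \forall n \near \oo, alpha n <= eps.
Hypothesis r_gt1 : 1 < r.

(** The values [f (theta n)] converge because they are almost nonincreasing on a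
    ball containing all iterates. Their limit is a value of [f] on that ball, so
    the Lojasiewicz inequality around this value applies at all late iterates at
    once, wherever they lie, and bounds all late displacements. *)
Lemma trajectory_cvg (R0 c : R) : (forall n, enorm (theta n) <= R0) -> 0 <= c ->
  (\forall n \near \oo, noise_max alpha r xi 1 n <= c) -> lojasiewicz f ->
  cvgn theta.
Proof.
move=> bnd c0 hc f_loj; have r0 : 0 <= r by rewrite ltW// (lt_trans ltr01).
pose S : set 'rV[R]_d := eball 0 R0.
have theta_S n : S (theta n) by rewrite /S /eball /= subr0.
have S0 : S 0.
  by rewrite /S /eball /= subrr enorm0 (le_trans (enorm_ge0 _) (bnd 0%N)).
have cS : compact S by exact: compact_eball.
have [L L1 hL] := lipschitz_on_compact grad_lip cS.
have L0 : 0 <= L by exact: le_trans L1.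
have vS : econvex S by exact: eball_convex.
have noise0 := noise_window_le alpha_gt0 gamma_y r0 c0 hc.
(* The noise level [c + 1] exceeds [c], and it is at least [1] as required in the
   critical case. *)
have B0 : 0 < c + 1 by rewrite ltr_wpDl.
have noiseB rho : rho < r \/ rho = r -> exists N, forall n j, (N <= n)%N -> (n <= j)%N ->
    gam j - gam n <= 1 ->
    enorm (\sum_(n <= i < j) alpha i *: xi i) <= noise_scale (c + 1) rho (gam n).
  move=> hrho; have hw : rho < r \/ rho = r /\ c <= c + 1.
    by case: hrho => ?; [left|right; rewrite lerDl].
  have [N1 _ H1] := noise_scale_weaken gamma_y c0 B0 hw.
  have [N2 _ H2] := noise0.
  exists (maxn N1 N2) => n j; rewrite geq_max => /andP[n1 n2] nj j1.
  exact: le_trans (H2 n n2 j nj j1) (H1 n n1).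
have [N hN] := noiseB r (or_intror erefl).
have Gmax n : enorm (grad f (theta n)) <= enorm (grad f 0) + L * R0.
  have := hL _ _ (theta_S n) S0; rewrite subr0 => h.
  rewrite -[grad f (theta n)](subrK (grad f 0)) (le_trans (enormD _ _))// addrC lerD2l.
  by rewrite (le_trans h)// ler_wpM2l.
have [A A0 hA] := value_almost_nonincreasing f_diff vS L1 hL alpha_gt0 theta_rec
  (fun n _ => theta_S n) gamma_y alpha_0 B0 r_gt1 hN (fun n _ => Gmax n).
have f_lower n : f 0 - (enorm (grad f 0) + L * R0) * R0 - L * R0 ^+ 2 <= f (theta n).
  have := descent_le f_diff vS hL L0 (theta_S n) S0; rewrite sub0r enormN.
  have h1 := edot_le (grad f (theta n)) (- theta n).
  have h2 : enorm (grad f (theta n)) * enorm (- theta n) <=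
      (enorm (grad f 0) + L * R0) * R0.
    by rewrite enormN ler_pM ?enorm_ge0.
  have h3 : L * enorm (theta n) ^+ 2 <= L * R0 ^+ 2.
    by rewrite ler_wpM2l// lerXn2r ?nnegrE ?enorm_ge0// (le_trans (enorm_ge0 _) (bnd n)).
  lra.
have tail eps : 0 < eps -> \forall n \near \oo,
    A * (gam n * noise_scale (c + 1) r (gam n)) <= eps.
  move=> e0; have e1 : 0 < eps / (A + 1) by rewrite divr_gt0// ltr_wpDl.
  apply: filterS (near_tail_small gamma_y B0 r_gt1 e1) => n h.
  rewrite (le_trans (ler_wpM2l A0 h))// mulrCA ler_piMr ?(ltW e0)//.
  by rewrite ler_pdivrMr ?ltr_wpDl// mul1r lerDl.
have [a ha] := almost_nonincreasing_cvg tail hA f_lower.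
have fa : (f @` S) a.
  have cfS : compact (f @` S).
    apply: continuous_compact cS; apply: continuous_subspaceT => x.
    exact: differentiable_continuous.
  have clfS : closed (f @` S) by apply: compact_closed cfS; exact: Rhausdorff.
  apply: (@closed_cvg _ _ \oo _ (fun n => f (theta n)) _ clfS).
    by near=> n; exists (theta n).
  by apply/cvgrPdist_le => eps /ha; apply: filterS => n; rewrite distrC.
have [de [mu [M [/andP[de0 _] mu12 M1 hM]]]] := f_loj S cS a fa.
have [rho1 hrho hcrit] : [/\ 1 < Defs.min_r r mu, Defs.min_r r mu < r \/ Defs.min_r r mu = r &
    Defs.min_r r mu * (2 - mu) < 1 \/ Defs.min_r r mu * (2 - mu) = 1].
  have [m1 [[_ -> h]|[_ -> h]|[_ h1 h2]]] := min_rP r_gt1 mu12.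
  - by split; [|right|left].
  - by split; [|right|right].
  - by split; [|left|right].
have [N1 hN1] := noiseB _ hrho.
have [N2 _ hN2] := ha de de0.
have hcB : Defs.min_r r mu * (2 - mu) < 1 \/ Defs.min_r r mu * (2 - mu) = 1 /\ 1 <= c + 1.
  by case: hcrit => ?; [left|right; rewrite lerDr].
have nois n j : (maxn N1 N2 <= n)%N -> (n <= j)%N -> gam j - gam n <= 1 ->
    enorm (\sum_(n <= i < j) alpha i *: xi i) <=
    noise_scale (c + 1) (Defs.min_r r mu) (gam n).
  by rewrite geq_max => /andP[n1 _]; exact: hN1.
have loj n : (maxn N1 N2 <= n)%N ->
    `|f (theta n) - a| <= M * enorm (grad f (theta n)) `^ mu.
  by rewrite geq_max => /andP[_ n2]; apply: hM => //; exact: hN2.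
have dist := near_distance_le f_diff vS L1 hL alpha_gt0 theta_rec
  (fun n _ => theta_S n) gamma_y alpha_0 B0 rho1 nois mu12 M1 loj ha hcB.
set D := 8 * _ in dist.
apply: cauchy_cvg; apply: cauchy_exP => eps eps0.
have e1 : 0 < eps / 2 / (`|D| + 1) by rewrite !divr_gt0// ltr_wpDl.
have [N3 _ hN3] : \forall n \near \oo,
    (forall k, (n <= k)%N -> enorm (theta k - theta n) <=
      D * (gam n * noise_scale (c + 1) (Defs.min_r r mu) (gam n))) /\
    gam n * noise_scale (c + 1) (Defs.min_r r mu) (gam n) <= eps / 2 / (`|D| + 1).
  by apply: filterI; [exact: dist|exact: near_tail_small].
have [hd ht] := hN3 N3 (leqnn _).
exists (theta N3); exists N3 => // k /= N3k; rewrite -ball_normE /=.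
rewrite distrC (le_lt_trans (normr_le_enorm _))// (le_lt_trans (hd k N3k))//.
have t0 : 0 <= gam N3 * noise_scale (c + 1) (Defs.min_r r mu) (gam N3).
  by rewrite mulr_ge0 ?gamma_ge0// mulr_ge0 ?powR_ge0// ltW.
rewrite (le_lt_trans (ler_wpM2r t0 (ler_norm D)))//.
have D0 : 0 <= `|D| by exact: normr_ge0.
rewrite (le_lt_trans (ler_wpM2l D0 ht))// mulrCA.
rewrite (@le_lt_trans _ _ (eps / 2))//; last by rewrite gtr_pMr// invf_lt1// ltr1n.
rewrite ler_piMr ?divr_ge0 ?(ltW eps0)//.
by rewrite ler_pdivrMr ?ltr_wpDl// mul1r lerDl.
Unshelve. all: by end_near. Qed.

(** Late iterates lie in the ball around the limit on which the constants attached
    to the limit are valid, so these constants determine the rates. *)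
Lemma trajectory_rates (th : 'rV[R]_d) (de mu M C c B : R) (rho := Defs.min_r r mu)
    (p := mu * rho) :
  theta n @[n --> \oo] --> th -> 0 < de -> 1 < mu <= 2 -> 1 <= M -> 1 <= C ->
  elipschitz_on C (eball th de) (grad f) ->
  (forall y, eball th de y -> `|f y - f th| <= M * enorm (grad f y) `^ mu) ->
  0 <= c -> (\forall n \near \oo, noise_max alpha r xi 1 n <= c) ->
  0 < B -> 1 < rho -> rho < r \/ rho = r /\ c <= B ->
  rho * (2 - mu) < 1 \/ rho * (2 - mu) = 1 /\ 1 <= B ->
  \forall n \near \oo,
  [/\ gam n `^ p * enorm (grad f (theta n)) ^+ 2 <= grad_const p C M * B `^ mu,
      gam n `^ p * `|f (theta n) - f th| <= abs_const p C M * B `^ mu &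
      gam n `^ (rho - 1) * enorm (theta n - th) <=
        8 * (abs_const p C M + dist_const rho p C M) * B].
Proof.
move=> cth de0 mu12 M1 C1 hC hM c0 hc B0 rho1 hrho hcrit.
have r0 : 0 <= r by rewrite ltW// (lt_trans ltr01).
have th_S : \forall n \near \oo, eball th de (theta n) := cth _ (near_eball th de0).
have [N1 _ H1] := th_S.
have [N2 _ H2] := noise_scale_weaken gamma_y c0 B0 hrho.
have [N3 _ H3] := noise_window_le alpha_gt0 gamma_y r0 c0 hc.
pose N := maxn N1 (maxn N2 N3).
have theta_S n : (N <= n)%N -> eball th de (theta n).
  by rewrite geq_max => /andP[n1 _]; exact: H1.
have nois n j : (N <= n)%N -> (n <= j)%N -> gam j - gam n <= 1 ->
    enorm (\sum_(n <= i < j) alpha i *: xi i) <= noise_scale B rho (gam n).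
  rewrite !geq_max => /and3P[_ n2 n3] nj j1.
  exact: le_trans (H3 n n3 j nj j1) (H2 n n2).
have loj n : (N <= n)%N -> `|f (theta n) - f th| <= M * enorm (grad f (theta n)) `^ mu.
  by move=> /theta_S; exact: hM.
have F0 eps : 0 < eps -> \forall n \near \oo, `|f (theta n) - f th| <= eps.
  have cf : f (theta n) @[n --> \oo] --> f th.
    exact: (cvg_comp _ _ cth (differentiable_continuous (f_diff th))).
  by move: cf => /cvgrPdist_le h /h; apply: filterS => n; rewrite distrC.
have vS : econvex (eball th de) by exact: eball_convex.
have gra := near_gradient_le f_diff vS C1 hC alpha_gt0 theta_rec theta_S gamma_y alpha_0
  B0 rho1 nois mu12 M1 loj F0 hcrit.
have val := near_value_abs f_diff vS C1 hC alpha_gt0 theta_rec theta_S gamma_y alpha_0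
  B0 rho1 nois mu12 M1 loj F0 hcrit.
have dis := near_distance_le f_diff vS C1 hC alpha_gt0 theta_rec theta_S gamma_y alpha_0
  B0 rho1 nois mu12 M1 loj F0 hcrit.
near=> n.
have g1 : 1 <= gam n by near: n; exact: gamma_y.
have gn : 0 < gam n by exact: lt_le_trans g1.
have scale a : gam n `^ p * (a * noise_scale B rho (gam n) `^ mu) = a * B `^ mu.
  rewrite powR_noise_scale ?(ltW B0)// powRN.
  by field; rewrite gt_eqF// powR_gt0.
split.
- by rewrite -scale ler_pM2l ?powR_gt0//; near: n.
- by rewrite -scale ler_pM2l ?powR_gt0//; near: n.
- set D := 8 * _.
  have hD : enorm (th - theta n) <= D * (gam n * noise_scale B rho (gam n)).
    have hk : forall k, (n <= k)%N -> enorm (theta k - theta n) <=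
        D * (gam n * noise_scale B rho (gam n)) by near: n.
    have hn : \forall k \near \oo,
        eball (theta n) (D * (gam n * noise_scale B rho (gam n))) (theta k).
      by exists n.
    have := @closed_cvg _ _ \oo _ theta (eball (theta n) _) (@closed_eball _ _ _ _) hn th.
    exact.
  rewrite enormBC; apply: (le_trans (ler_wpM2l (powR_ge0 _ _) hD)).
  rewrite noise_scale_time// powRN le_eqVlt; apply/orP; left; apply/eqP.
  by field; rewrite gt_eqF// powR_gt0.
Unshelve. all: by end_near. Qed.

End Trajectory.

(** * The constant of the theorem *)

Section FinalConstant.
Context {R : realType}.
Implicit Types (r p C M : R).

(** The distance estimate involves [1 / (rho - 1)] for [rho = min r (1 / (2 - mu))];
    this is [1 / (r - 1)] or [2 / (p - 1)], as [p = 2 * rho - 1] in the second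
    case. The maximum with [1] makes the constant positive also where [p], [C],
    [M] do not come from the theorem. *)
Definition rate_const r p C M : R :=
  Num.max 1 (grad_const p C M + abs_const p C M +
    8 * (abs_const p C M + 4 * (16 * C) * ((r - 1)^-1 + 2 * (p - 1) `^ (-1)) *
      (67 * C + p * abs_const p C M + 1))).

Lemma rate_const_gt0 r p C M : 0 < rate_const r p C M.
Proof. by rewrite lt_max ltr01. Qed.

Lemma measurable_rate_const r :
  measurable_fun [set: R * R * R] (fun x => rate_const r x.1.1 x.1.2 x.2).
Proof.
have m1 : measurable_fun [set: R * R * R] (fun x => x.1.1).
  exact: (measurableT_comp measurable_fst measurable_fst).
have m2 : measurable_fun [set: R * R * R] (fun x => x.1.2).
  exact: (measurableT_comp measurable_snd measurable_fst).
have m3 : measurable_fun [set: R * R * R] (fun x => x.2) by exact: measurable_snd.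
have cst_ (c : R) : measurable_fun [set: R * R * R] (fun=> c) by exact: measurable_cst.
have mabs : measurable_fun [set: R * R * R] (fun x => abs_const x.1.1 x.1.2 x.2).
  apply: measurable_funM; first exact: (measurableT_comp (measurable_powRr 2) m1).
  apply: measurable_funM; first exact: measurable_funM.
  apply: measurable_funD; first by apply: measurable_funX; exact: measurable_funM.
  apply: (measurableT_comp (@measurable_expR R)).
  apply: measurable_funM => //; apply: measurable_funM => //.
  exact: measurable_funX.
have m67 : measurable_fun [set: R * R * R] (fun x => 67 * x.1.2) by exact: measurable_funM.
have m16 : measurable_fun [set: R * R * R] (fun x => 16 * x.1.2) by exact: measurable_funM.
apply: measurable_maxr => //; apply: measurable_funD.
  apply: measurable_funD => //; apply: measurable_funM; first exact: measurable_funM.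
  by apply: measurable_funD => //; exact: measurable_funM.
apply: measurable_funM => //; apply: measurable_funD => //.
apply: measurable_funM.
  apply: measurable_funM; first exact: measurable_funM.
  apply: measurable_funD => //; apply: measurable_funM => //.
  apply: (measurableT_comp (measurable_powR (-1))).
  exact: measurable_funB.
apply: measurable_funD => //; apply: measurable_funD => //.
exact: measurable_funM.
Qed.

Lemma rate_const_ge r mu C M (rho := Defs.min_r r mu) (p := mu * rho) :
  1 < r -> 1 < mu <= 2 -> 1 <= C -> 1 <= M ->
  [/\ grad_const p C M <= rate_const r p C M, abs_const p C M <= rate_const r p C M &
      8 * (abs_const p C M + dist_const rho p C M) <= rate_const r p C M].
Proof.
move=> r1 mu12 C1 M1; have [rho1 cases] := min_rP r1 mu12.
have C0 : 0 < C by exact: lt_le_trans C1.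
have a0 : 0 < abs_const p C M by rewrite abs_const_gt0// (lt_le_trans ltr01).
have mu1 : 1 < mu by case/andP: mu12.
have rho_p : rho <= p by rewrite /p ler_peMl ?(ltW mu1)// ltW// (lt_trans ltr01).
have p1 : 1 < p by exact: lt_le_trans rho_p.
have C16 : 0 < 4 * (16 * C) by rewrite !mulr_gt0.
have C67 : 0 < 67 * C by exact: mulr_gt0.
have g0 : 0 < grad_const p C M.
  by rewrite /grad_const mulr_gt0 ?mulr_gt0// addr_gt0// mulr_gt0.
have rp0 : 0 < rho * abs_const p C M by rewrite mulr_gt0// (lt_trans ltr01).
have i0 : 0 < (r - 1)^-1 by rewrite invr_gt0 subr_gt0.
have ip0 : 0 < (p - 1) `^ (-1) by rewrite powR_gt0// subr_gt0.
have inv_le : (rho - 1)^-1 <= (r - 1)^-1 + 2 * (p - 1) `^ (-1).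
  have [[_ rE _]|[_ rE _]|[_ _ crit]] := cases.
  - by rewrite /rho rE lerDl mulr_ge0// ltW.
  - by rewrite /rho rE lerDl mulr_ge0// ltW.
  - have pE : p - 1 = 2 * (rho - 1).
      have e : mu * rho = 2 * rho - rho * (2 - mu) by ring.
      by rewrite /p e crit; ring.
    rewrite powR_inv1 ?subr_ge0 ?(ltW p1)// pE.
    have -> : 2 * (2 * (rho - 1))^-1 = (rho - 1)^-1 by field; rewrite subr_eq0 gt_eqF.
    by rewrite lerDr ltW.
have i1 : 0 < (rho - 1)^-1 by rewrite invr_gt0 subr_gt0.
have le_d : dist_const rho p C M <= 4 * (16 * C) *
    ((r - 1)^-1 + 2 * (p - 1) `^ (-1)) * (67 * C + p * abs_const p C M + 1).
  rewrite /dist_const; apply: ler_pM.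
  - by rewrite ltW// mulr_gt0.
  - by rewrite ltW// !addr_gt0.
  - by rewrite ler_pM2l.
  - by rewrite lerD2r lerD2l ler_pM2r.
have d0 : 0 < dist_const rho p C M by rewrite /dist_const !mulr_gt0// !addr_gt0.
rewrite /rate_const; set Dm := 4 * (16 * C) * _ * _ in le_d *.
have D0 : 0 < 8 * (abs_const p C M + Dm).
  by rewrite mulr_gt0// addr_gt0// (lt_le_trans d0).
split; rewrite le_max; apply/orP; right.
- by rewrite -addrA lerDl addr_ge0// ltW.
- by rewrite -addrA addrCA lerDl addr_ge0// ltW.
- rewrite (@le_trans _ _ (8 * (abs_const p C M + Dm)))//; last first.
    by rewrite lerDr addr_ge0// ltW.
  by rewrite ler_pM2l// lerD2l.
Qed.

End FinalConstant.

(** * The theorem *)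

Section InfimumOfBounds.
Context {R : realType}.

(** Right continuity of the power at [z]: for each [e] there is [B > z] with
    [k * B ^ mu = k * z ^ mu + e]. *)
Lemma le_powR_of_gt (L : \bar R) (k z mu : R) : 0 < k -> 0 <= z -> 0 < mu ->
  (forall B, z < B -> (L <= (k * B `^ mu)%:E)%E) -> (L <= (k * z `^ mu)%:E)%E.
Proof.
move=> k0 z0 mu0 hL; apply/lee_addgt0Pr => e e0.
pose B := (z `^ mu + e / k) `^ mu^-1.
have ek : 0 < e / k by exact: divr_gt0.
have BE : B `^ mu = z `^ mu + e / k.
  by rewrite -powRrM mulVf ?gt_eqF// powRr1// addr_ge0 ?powR_ge0// ltW.
have zB : z < B.
  rewrite ltNge; apply/negP => Bz.
  have : B `^ mu <= z `^ mu.
    by apply: ge0_ler_powR Bz; rewrite ?nnegrE ?powR_ge0 ?(ltW mu0).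
  by rewrite BE gerDl leNgt ek.
by rewrite (le_trans (hL B zB))// BE mulrDr (mulrC k (e / k)) divfK ?gt_eqF.
Qed.

Lemma le_mul_of_gt (L : \bar R) (k z : R) : 0 < k -> 0 <= z ->
  (forall B, z < B -> (L <= (k * B)%:E)%E) -> (L <= (k * z)%:E)%E.
Proof.
move=> k0 z0 hL; have := @le_powR_of_gt L k z 1 k0 z0 ltr01.
rewrite powRr1//; apply=> B zB; rewrite powRr1; first exact: hL.
by rewrite ltW// (le_lt_trans z0).
Qed.

End InfimumOfBounds.

Lemma bounded_seq_enorm_le {R : realType} {d : nat} (u : nat -> 'rV[R]_d) :
  bounded_seq u -> exists R0, forall n, enorm (u n) <= R0.
Proof.
rewrite /bounded_seq => b; set s := ereal_sup _ in b.
have le_s n : ((enorm (u n))%:E <= s)%E by apply: ereal_sup_ubound; exists n.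
exists (fine s) => n; rewrite -lee_fin fineK// fin_numE.
have s0 : (-oo < s)%E by apply: lt_le_trans (le_s n); exact: ltNyr.
by rewrite (gt_eqF s0) (lt_eqF b).
Qed.

Theorem theorem2p2 (R : realType) (r : R) (hr : 1 < r) :
  exists kappa : R -> R -> R -> R,
    [/\ measurable_fun [set: R * R * R] (fun x => kappa x.1.1 x.1.2 x.2),
        (forall p C M, 0 < kappa p C M) &
  forall (d : nat) (f : 'rV[R]_d -> R) (alpha : nat -> R)
    (disp : measure_display) (Omega : measurableType disp)
    (P : probability Omega R)
    (theta xi : nat -> Omega -> 'rV[R]_d)
    (delta mu M C : 'rV[R]_d -> R)
    (f_diff : forall x, differentiable f x)
    (grad_lip : locally_elipschitz (grad f))
    (alpha_gt0 : forall n, 0 < alpha n)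
    (theta_rv : forall n, random_vector (theta n))
    (xi_rv : forall n, random_vector (xi n))
    (theta_rec : forall n w,
      theta n.+1 w = theta n w - alpha n *: (grad f (theta n w) + xi n w))
    (alpha_to0 : alpha n @[n --> \oo] --> 0)
    (alpha_sum : series alpha n @[n --> \oo] --> +oo)
    (noise : \forall w \ae P, bounded_seq (theta ^~ w) ->
      forall t : R, 0 < t -> (noise_limsup alpha r (xi ^~ w) t < +oo)%E)
    (f_loj : lojasiewicz f)
    (f_local_loj : local_lojasiewicz f delta mu M)
    (f_local_bound : local_grad_bound f delta C),
  let theta_hat w := limn (theta ^~ w) in
  let mu_hat w := mu (theta_hat w) in
  let p_hat w := p_of r (mu_hat w) in
  let q_hat w := q_of r (mu_hat w) in
  let xi_lim w := noise_limsup alpha r (xi ^~ w) 1 in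
  let phi_xi w := phi r (mu_hat w) (xi_lim w) in
  let K_hat w := kappa (p_hat w) (C (theta_hat w)) (M (theta_hat w)) in
  \forall w \ae P, bounded_seq (theta ^~ w) ->
    [/\ cvgn (theta ^~ w),
        (limn_esup (fun n => (gamma alpha n `^ p_hat w *
            enorm (grad f (theta n w)) ^+ 2)%:E)
          <= (K_hat w)%:E * phi_xi w `^ mu_hat w)%E,
        (limn_esup (fun n => (gamma alpha n `^ p_hat w *
            `|f (theta n w) - f (theta_hat w)|)%:E)
          <= (K_hat w)%:E * phi_xi w `^ mu_hat w)%E &
        (limn_esup (fun n => (gamma alpha n `^ q_hat w *
            enorm (theta n w - theta_hat w))%:E)
          <= (K_hat w)%:E * phi_xi w)%E]].
Proof.
exists (rate_const r); split; first exact: measurable_rate_const.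
  by move=> p C M; exact: rate_const_gt0.
move=> d f alpha disp Omega P theta xi delta mu M C f_diff grad_lip alpha_gt0 _ _.
move=> theta_rec alpha_to0 alpha_sum noise f_loj f_local_loj f_local_bound.
move=> theta_hat mu_hat p_hat q_hat xi_lim phi_xi K_hat.
have gamma_y A : \forall n \near \oo, A <= gamma alpha n.
  by move/cvgryPge : alpha_sum; exact.
have alpha_0 eps : 0 < eps -> \forall n \near \oo, alpha n <= eps.
  move=> e0; move/cvgrPdist_le : alpha_to0 => /(_ eps e0); apply: filterS => n.
  by rewrite sub0r normrN; apply: le_trans; exact: ler_norm.
apply: filterS noise => w noise_w bw.
have rec_w n : theta n.+1 w = theta n w - alpha n *: (grad f (theta n w) + xi n w).
  exact: theta_rec.
have [R0 bnd] := bounded_seq_enorm_le bw.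
have xi_fin : (xi_lim w < +oo)%E by exact: noise_w.
have xi_ge0 : (0 <= xi_lim w)%E.
  by apply: limn_esup_ge0 => n; exact: Order.TotalTheory.bigmax_ge_id.
have [z z0 xiE] : exists2 z, 0 <= z & xi_lim w = z%:E.
  exists (fine (xi_lim w)); first exact: fine_ge0.
  by rewrite fineK// ge0_fin_numE.
have noise_near c : z < c -> \forall n \near \oo, noise_max alpha r (xi ^~ w) 1 n <= c.
  move=> zc; have xi_c : (xi_lim w < c%:E)%E by rewrite xiE lte_fin.
  exact: near_le_of_limn_esup_lt xi_c.
have z1 : z < z + 1 by rewrite ltrDl.
have z1_ge0 : 0 <= z + 1 by rewrite addr_ge0.
have cv : cvgn (theta ^~ w).
  exact: (trajectory_cvg f_diff grad_lip alpha_gt0 rec_w gamma_y alpha_0 hr bnd z1_ge0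
    (noise_near _ z1) f_loj).
have [/andP[de0 _] mu12 M1 hM] := f_local_loj (theta_hat w).
have [C1 _ hC] := f_local_bound (theta_hat w).
have [rho1 cases] := min_rP hr mu12.
have [kg ka kd] := rate_const_ge hr mu12 C1 M1.
have mu0 : 0 < mu_hat w by case/andP: mu12 => m1 _; exact: lt_trans m1.
have K0 : 0 < K_hat w := rate_const_gt0 _ _ _ _.
(* The three bounds for a noise level [B]; [c] bounds the averaged noise. *)
have rates B c : 0 < B -> z < c ->
    Defs.min_r r (mu_hat w) < r \/ Defs.min_r r (mu_hat w) = r /\ c <= B ->
    Defs.min_r r (mu_hat w) * (2 - mu_hat w) < 1 \/
      Defs.min_r r (mu_hat w) * (2 - mu_hat w) = 1 /\ 1 <= B ->
    [/\ (limn_esup (fun n => (gamma alpha n `^ p_hat w *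
            enorm (grad f (theta n w)) ^+ 2)%:E) <= (K_hat w * B `^ mu_hat w)%:E)%E,
        (limn_esup (fun n => (gamma alpha n `^ p_hat w *
            `|f (theta n w) - f (theta_hat w)|)%:E) <= (K_hat w * B `^ mu_hat w)%:E)%E &
        (limn_esup (fun n => (gamma alpha n `^ q_hat w *
            enorm (theta n w - theta_hat w))%:E) <= (K_hat w * B)%:E)%E].
  move=> B0 zc hrho hcrit; have c0 : 0 <= c by rewrite ltW// (le_lt_trans z0).
  have H := trajectory_rates f_diff alpha_gt0 rec_w gamma_y alpha_0 hr cv de0 mu12 M1 C1
    hC hM c0 (noise_near c zc) B0 rho1 hrho hcrit.
  split; apply: limn_esup_le_of_near; apply: filterS H => n [h1 h2 h3].
  - by apply: (le_trans h1); apply: ler_wpM2r kg; exact: powR_ge0.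
  - by apply: (le_trans h2); apply: ler_wpM2r ka; exact: powR_ge0.
  - by apply: (le_trans h3); apply: ler_wpM2r kd; exact: ltW.
have phiE : phi_xi w = phi r (mu_hat w) z%:E by rewrite /phi_xi xiE.
have [[c1 c2 c3]|[c1 c2 c3]|[c1 c2 c3]] := cases.
(* [r < 1 / (2 - mu)]: every [B > xi] is allowed, hence the bound with [xi]. *)
- rewrite c2 in rates.
  have low B (zB : z < B) := rates B B (le_lt_trans z0 zB) zB
    (or_intror (conj erefl (lexx B))) (or_introl c3).
  rewrite phiE /phi c1 poweR_EFin -!EFinM; split=> //.
  - by apply: le_powR_of_gt => // B /low[].
  - by apply: le_powR_of_gt => // B /low[].
  - by apply: le_mul_of_gt => // B /low[].
(* [r = 1 / (2 - mu)]: the comparison requires [1 <= B]. *)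
- have [|b1 b2 b3] := rates (z + 1) (z + 1) (le_lt_trans z0 z1) z1
    (or_intror (conj c2 (lexx _))).
    by right; rewrite c2 lerDr.
  by rewrite phiE /phi -c1 ltxx eqxx -EFinD addrC poweR_EFin -!EFinM.
(* [r > 1 / (2 - mu)]: the noise is negligible, whatever its size. *)
- have [||b1 b2 b3] := rates 1 (z + 1) ltr01 z1; [by left|by right|].
  rewrite phiE /phi (lt_gtF c1) (gt_eqF c1) poweR1r -EFinM.
  by rewrite powR1 in b1 b2.
Qed.
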